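(* Let $F$ be a SWF on a finite set of voters $V$ with $|V|=3k+1$ or $|V|=3k+2$, for $k$ sufficiently large, and with candidate set $C=\{c_1,c_2,c_3\}$, satisfying conditions CC, MIIA, N, PR and TA. Let $d\in\{d_1(a):a\in A\}$ with $|d|>1$, let $a_d$ be a relative election drawn uniformly at random from $A_d=\{a\in A: d_1(a)=d\}$, and let $e\in\pi_{i,j}^{-1}(a_d)$ be an election (where $i\neq j$ are such that $a_d\in A_{i,j}$). Then with probability at least $\frac{5}{3\sqrt3}+O(1/k)$ we have either $\pi_{i,j}(F(e))=\pi_{i,j}(B_1(e))=\varphi(d)$ or $\pi_{i,j}(F(e))=T$.
   Context: Setting. $V$ is a finite set of voters, $C=\{c_1,c_2,c_3\}$ is the set of candidates, with indices treated modulo $3$. A ballot is a bijection $r:C\to\{0,1,2\}$ ($r^{-1}(2)$ is the highest ranked candidate, $r^{-1}(0)$ the lowest); it is also written as the list of candidates from highest to lowest. $\mathfrak{R}$ is the set of all ballots. The Condorcet cycle is $\mathfrak{C}=\{c_1c_2c_3,\ c_2c_3c_1,\ c_3c_1c_2\}\subset\mathfrak{R}$. An election domain is a subset $E\subset\mathfrak{R}^V$; its elements are elections $e$, with $e(v)$ the ballot of $v$. An election result $\succ$ is a weak ordering of $C$ (ties allowed). A SWF (social welfare function) is a function $F$ from $E$ to the set of weak orderings of $C$. Condition CC: $E=\mathfrak{C}^V$. For $i\ne j$ and $e\in E$ let the relative election $\pi_{i,j}(e)\in\mathbb{Z}^V$ be $\pi_{i,j}(e)(v)=e(v)(c_i)-e(v)(c_j)$;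 let $A_{i,j}=\pi_{i,j}(E)$ and $A=\bigcup_{i\ne j}A_{i,j}$. Under CC, $A_{i,i+1}=\{1,-2\}^V$ and $A_{i+1,i}=\{2,-1\}^V$. For a result $\succ$, $\pi_{i,j}(\succ)=W$ if $c_i\succ c_j$, $L$ if $c_j\succ c_i$, and $T$ if they are tied. The symbols are ordered $W>T>L$. For real $x$, $\varphi(x)=W$ if $x>0$, $T$ if $x=0$, $L$ if $x<0$. For $a\in A$, $d_1(a)=\sum_{v\in V}a(v)$. MIIA: for all $i\ne j$ there is a function (relative SWF) $f_{i,j}:A_{i,j}\to\{W,T,L\}$ with $f_{i,j}(\pi_{i,j}(e))=\pi_{i,j}(F(e))$ for all $e\in E$. N (neutrality): for every permutation $\rho$ of $C$ and every $e\in E$ such that the election $\rho\circ e$ (obtained by relabelling the candidates in every ballot by $\rho$) lies in $E$, $F(\rho\circ e)=\rho(F(e))$, where $\rho$ acts on weak orderings by relabelling candidates. PR (positive responsiveness): for all $i\neq j$, if $a_1,a_2\in A_{i,j}$ and $a_1(v)\ge a_2(v)$ for all $v$, then $f_{i,j}(a_1)\ge f_{i,j}(a_2)$. TA (transitive anonymity): there is a group $G$ acting transitively on $V$ such that $F(g(e))=F(e)$ for all $g\in G$, $e\in E$, where $g(e)(v)=e(g(v))$. $B_1$ is the positive unweighted Borda rule: the SWF ranking candidates by the score $\sum_{v\in V}e(v)(c_i)$ (higher score wins, equal scores tie). $O(1/k)$ denotes a quantity bounded in absolute value by $K/k$ for an absolute constant $K$ (independent of $k,V,F,d,i,j$). 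*)

(* Defs.v *)
From HB Require Import structures.
From mathcomp Require Import all_boot all_order all_algebra all_fingroup.
From mathcomp Require Import finmap reals.

Set Implicit Arguments.
Unset Strict Implicit.
Unset Printing Implicit Defensive.

Import Order.TTheory GRing.Theory Num.Theory.

Local Open Scope ring_scope.

(* The candidates c_1, c_2, c_3 are the elements 0, 1, 2 of 'I_3. *)
Definition cand := 'I_3.

Definition cand1 : cand := @Ordinal 3 0 isT.
Definition cand2 : cand := @Ordinal 3 1 isT.
Definition cand3 : cand := @Ordinal 3 2 isT.

(* A ballot is a bijection from cand to {0, 1, 2}; since both sides are 'I_3,
   it is a permutation.  The value 2 is the top rank and 0 the bottom rank. *)
Definition ballot := {perm cand}.

Definition ballot_is (r : ballot) (x y z : cand) : bool :=
  [&& r x == 2 :> nat, r y == 1 :> nat & r z == 0 :> nat]%N.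

Definition condorcet_cycle : {set ballot} :=
  [set r | [|| ballot_is r cand1 cand2 cand3, ballot_is r cand2 cand3 cand1
             | ballot_is r cand3 cand1 cand2]].

(* A weak ordering is the set of pairs (x, y) such that x is ranked at least
   as high as y. *)
Definition is_weak_order (S : {set cand * cand}) : bool :=
  [forall x, forall y, ((x, y) \in S) || ((y, x) \in S)] &&
  [forall x, forall y, forall z,
     ((x, y) \in S) ==> ((y, z) \in S) ==> ((x, z) \in S)].

Definition weak_order := {S : {set cand * cand} | is_weak_order S}.

Definition prefers (w : weak_order) (x y : cand) : bool :=
  ((x, y) \in val w) && ((y, x) \notin val w).

Lemma score_is_weak_order (s : cand -> nat) :
  is_weak_order [set p | (s p.2 <= s p.1)%N].
Proof.
apply/andP; split.
  by apply/forallP => x; apply/forallP => y; rewrite !inE /= leq_total.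
apply/forallP => x; apply/forallP => y; apply/forallP => z; rewrite !inE /=.
by apply/implyP => yx; apply/implyP => zy; apply: leq_trans yx.
Qed.

Definition order_of_score (s : cand -> nat) : weak_order :=
  exist (fun S => is_true (is_weak_order S)) _
    (score_is_weak_order s).

Lemma relabel_is_weak_order (rho : {perm cand}) (w : weak_order) :
  is_weak_order [set p | ((rho^-1)%g p.1, (rho^-1)%g p.2) \in val w].
Proof.
case: w => S /= /andP[/forallP tot /forallP trans].
apply/andP; split.
  by apply/forallP => x; apply/forallP => y; rewrite !inE /=;
     move/forallP: (tot ((rho^-1)%g x)).
apply/forallP => x; apply/forallP => y; apply/forallP => z; rewrite !inE /=.
by move/forallP: (trans ((rho^-1)%g x)) => /(_ ((rho^-1)%g y)) /forallP.
Qed.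

(* rho x is ranked at least as high as rho y in relabel_order rho w if and only
   if x is ranked at least as high as y in w. *)
Definition relabel_order (rho : {perm cand}) (w : weak_order) : weak_order :=
  exist (fun S => is_true (is_weak_order S)) _
    (relabel_is_weak_order rho w).

Variant outcome := Win | Tie | Loss.

Definition outcome_rank (o : outcome) : 'I_3 :=
  match o with Win => inord 2 | Tie => inord 1 | Loss => inord 0 end.
Definition outcome_unrank (n : 'I_3) : outcome :=
  match val n with 2 => Win | 1 => Tie | _ => Loss end.
Lemma outcome_rankK : cancel outcome_rank outcome_unrank.
Proof. by case; rewrite /outcome_unrank /= inordK. Qed.
HB.instance Definition _ := Equality.copy outcome (can_type outcome_rankK).

Definition outcome_le (o1 o2 : outcome) : bool :=
  (outcome_rank o1 <= outcome_rank o2)%N.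

Definition outcome_of (w : weak_order) (i j : cand) : outcome :=
  if prefers w i j then Win
  else if prefers w j i then Loss else Tie.

Definition phi {R : realDomainType} (x : R) : outcome :=
  if 0 < x then Win else if x == 0 then Tie else Loss.

Definition election (V : finType) := {ffun V -> ballot}.

Definition rel_election (V : finType) := {ffun V -> int}.

Definition rel_of (V : finType) (i j : cand) (e : election V) :
    rel_election V :=
  [ffun v => (e v i : nat)%:Z - (e v j : nat)%:Z].

Definition d1 (V : finType) (a : rel_election V) : int := \sum_(v : V) a v.

Definition rel_elections_of (V : finType) (E : {set election V}) (i j : cand) :
    {fset rel_election V} :=
  [fset rel_of i j e | e in E]%fset.

Definition rel_elections (V : finType) (E : {set election V}) :
    {fset rel_election V} :=
  (\bigcup_(p <- enum {: cand * cand} | p.1 != p.2)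
     rel_elections_of E p.1 p.2)%fset.

Definition rel_elections_with (V : finType) (E : {set election V}) (d : int) :
    {fset rel_election V} :=
  [fset a in rel_elections E | d1 a == d]%fset.

Definition swf (V : finType) (E : {set election V}) :=
  {e : election V | e \in E} -> weak_order.

(* (rho o e)(v) gives rho c the rank that e(v) gives c. *)
Definition relabel_election (V : finType) (rho : {perm cand})
    (e : election V) : election V :=
  [ffun v => (rho^-1 * e v)%g].

Definition CC (V : finType) (E : {set election V}) : Prop :=
  E = [set e : election V | [forall v, e v \in condorcet_cycle]].

(* Only the values of f i j on rel_elections_of E i j, for i != j, matter. *)
Definition MIIA (V : finType) (E : {set election V}) (F : swf E)
    (f : cand -> cand -> rel_election V -> outcome) : Prop :=
  forall i j : cand, i != j -> forall e : {e : election V | e \in E},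
    f i j (rel_of i j (val e)) = outcome_of (F e) i j.

Definition neutrality (V : finType) (E : {set election V}) (F : swf E) : Prop :=
  forall (rho : {perm cand}) (e e' : {e : election V | e \in E}),
    val e' = relabel_election rho (val e) -> F e' = relabel_order rho (F e).

Definition positive_responsiveness (V : finType) (E : {set election V})
    (f : cand -> cand -> rel_election V -> outcome) : Prop :=
  forall i j : cand, i != j -> forall a1 a2 : rel_election V,
    a1 \in rel_elections_of E i j -> a2 \in rel_elections_of E i j ->
    (forall v, a2 v <= a1 v) -> outcome_le (f i j a2) (f i j a1).

(* act is an action of the (possibly infinite) group G on V. *)
Definition transitive_action (V : finType) (G : groupType)
    (act : G -> V -> V) : Prop :=
  [/\ forall v, act 1%g v = v,
      forall g h v, act (g * h)%g v = act g (act h v)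
    & forall v w, exists g, act g v = w].

Definition transitive_anonymity (V : finType) (E : {set election V})
    (F : swf E) : Prop :=
  exists (G : groupType) (act : G -> V -> V),
    transitive_action act /\
    forall (g : G) (e e' : {e : election V | e \in E}),
      val e' = [ffun v => val e (act g v)] -> F e' = F e.

Definition borda (V : finType) (E : {set election V}) : swf E :=
  fun e => order_of_score (fun c => (\sum_(v : V) (val e v c : nat))%N).

(* The event on a relative election a with d1 a = d.  It is required for every
   pair i != j and every e in E with rel_of i j e = a. *)
Definition agrees_or_ties (V : finType) (E : {set election V}) (F : swf E)
    (d : int) (a : rel_election V) : bool :=
  [forall i : cand, forall j : cand, (i != j) ==>
    [forall e : {e : election V | e \in E}, (rel_of i j (val e) == a) ==>
      ((outcome_of (F e) i j == outcome_of (borda e) i j) &&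
         (outcome_of (borda e) i j == phi d))
      || (outcome_of (F e) i j == Tie)]].

Definition uniform_prob (R : realType) (X : choiceType) (S : {fset X})
    (P : pred X) : R :=
  #|` [fset x in S | P x]%fset|%:R / #|` S|%:R.

(* Main.v *)
Require Import Defs.
From mathcomp Require Import all_boot all_order all_algebra all_fingroup.
From mathcomp Require Import finmap reals.
From mathcomp Require Import ring lra zify.

Set Implicit Arguments.
Unset Strict Implicit.
Unset Printing Implicit Defensive.

Import Order.TTheory GRing.Theory Num.Theory.
Local Open Scope ring_scope.

(** Under CC an election is an ordered partition (S_0, S_1, S_2) of V, where S_i
    is the bloc ranking c_i last and c_(i+1) first.  By MIIA and N the outcome
    between c_i and c_(i+1) is u(S_i) for a single function u with values 1, 0, -1
    (win, tie, loss); u is antitone by PR, and as results are weak orders, each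
    partition has either u = 0 on all three blocs or the sum of the three
    pairwise products equal to -1.

    Average that relation over the partitions of type (s, s, t), s and t close to
    n/3.  On functions of sets of a fixed size, passing to a random disjoint set
    acts on the j-th level of the Johnson scheme by a scalar close to (-1/2)^j.
    TA kills level 1, the only level with a strongly negative scalar, so the
    average is controlled by the means y and x of u on sets of size s and t:
    6/5 y^2 + 2xy + 2/5 x^2 + 2/5 E[u^2 | size t] <= 0.  Since x and y are also
    ordered by monotonicity, u takes the wrong sign on at most 1/50 of the sets
    of size t.  As 49/50 > 5/(3 sqrt 3), no error term is needed. *)

(** * Harmonic functions on the lattice of subsets *)

(** Least squares: the residual of [f] after projection onto the rows of [K] is orthogonal to these
    rows. Over an ordered field, [x *m A *m A^T = 0] forces the sum of squares of the entries of
    [x *m A] to vanish, so [A *m A^T] and [A^T] have the same row space. *)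
Lemma normal_equations (R : realFieldType) (T : finType) (K : T -> T -> R)
    (f : T -> R) :
  exists w : T -> R, forall x, \sum_y K x y * (f y - \sum_z w z * K z y) = 0.
Proof.
pose A : 'M[R]_#|T| := \matrix_(i, j) K (enum_val i) (enum_val j).
pose u : 'rV[R]_#|T| := \row_j f (enum_val j).
have kerA : (kermx (A *m A^T) <= kermx A)%MS.
  apply/rV_subP => x /sub_kermxP xAA; apply/sub_kermxP.
  have /matrixP/(_ 0 0) : (x *m A) *m (x *m A)^T = 0.
    by rewrite trmx_mul mulmxA -(mulmxA x) xAA mul0mx.
  rewrite !mxE => H; apply/rowP => j; rewrite [RHS]mxE.
  have /eqP : (x *m A) 0 j * (x *m A)^T j 0 = 0.
    by apply: (psumr_eq0P _ H) => // i _; rewrite [_^T _ _]mxE -expr2 sqr_ge0.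
  by rewrite [_^T _ _]mxE -expr2 sqrf_eq0 => /eqP.
have rk : (A^T <= A *m A^T)%MS.
  suff: (A *m A^T == A^T)%MS by case/andP.
  rewrite -(geq_leqif (mxrank_leqif_eq (submxMl _ _))) mxrank_tr.
  have := mxrankS kerA; rewrite !mxrank_ker.
  have := rank_leq_row A; have := rank_leq_row (A *m A^T).
  by move: (\rank _) (\rank _) => r1 r2; lia.
have /submxP[w uw] : (u *m A^T <= A *m A^T)%MS.
  exact: submx_trans (submxMl _ _) rk.
exists (fun z => w 0 (enum_rank z)) => x.
have := congr1 (fun M : 'rV_#|T| => M 0 (enum_rank x)) uw.
rewrite mulmxA !mxE => E.
under eq_bigr do rewrite mulrBr; rewrite sumrB; apply/eqP; rewrite subr_eq0.
apply/eqP; transitivity (\sum_j u 0 j * A^T j (enum_rank x)).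
  rewrite [LHS](reindex_onto (enum_val : 'I_#|T| -> T) enum_rank) /=; last first.
    by move=> i _; rewrite enum_rankK.
  by apply: eq_big => [i|i _]; rewrite ?enum_valK ?eqxx // !mxE enum_rankK mulrC.
rewrite E [RHS](reindex_onto (enum_val : 'I_#|T| -> T) enum_rank) /=; last first.
  by move=> i _; rewrite enum_rankK.
apply: eq_big => [i|i _]; rewrite ?enum_valK ?eqxx // !mxE enum_rankK mulrC.
congr (_ * _).
rewrite [RHS](reindex_onto (enum_val : 'I_#|T| -> T) enum_rank) /=; last first.
  by move=> z _; rewrite enum_rankK.
by apply: eq_big => [z|z _]; rewrite ?enum_valK ?eqxx // !mxE.
Qed.

Section Subsets.
Variable V : finType.
Local Notation n := #|V|.

(** Double counting of the flags formed by [B] and [v |: B]; harmonicity and monotonicity of means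
    are both exploited through it. *)
Lemma sum_flag (M : nmodType) (G : {set V} -> V -> M) :
  \sum_(A : {set V}) \sum_(v in A) G A v =
  \sum_(B : {set V}) \sum_(v | v \notin B) G (v |: B) v.
Proof.
rewrite (exchange_big_dep predT) //= [RHS](exchange_big_dep predT) //=.
apply: eq_bigr => v _.
rewrite (reindex_onto (fun B => v |: B) (fun A => A :\ v)) /=; last first.
  by move=> A vA; rewrite setD1K.
apply: eq_bigl => B; rewrite setU11 /=; apply/eqP/idP => [<-|vB].
  by rewrite setD11.
by rewrite setU1K.
Qed.

Lemma card_between (A B : {set V}) m : A \subset B ->
  #|[set S : {set V} | [&& A \subset S, S \subset B & #|S| == (m + #|A|)%N]]| =
  'C(#|B| - #|A|, m).
Proof.
move=> AB; have <- : #|B :\: A| = (#|B| - #|A|)%N by rewrite cardsDS.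
rewrite -cards_draws -!sum1dep_card.
rewrite (reindex_onto (fun S => A :|: S) (fun S => S :\: A)) /=; last first.
  move=> S /and3P[AS _ _]; apply/setP => x; rewrite !inE.
  by case: (boolP (x \in A)) => //= /(subsetP AS) ->.
apply: eq_bigl => S; rewrite subsetUl subUset AB /=.
apply/andP/andP.
  case=> /andP[SB cS] /eqP e; have dAS : [disjoint A & S].
    by rewrite -e -setI_eq0; apply/eqP/setP => x; rewrite !inE; case: (x \in A).
  split; first by rewrite subsetD SB disjoint_sym.
  by move: cS; rewrite cardsU (eqP (_ : A :&: S == set0)) ?setI_eq0 // cards0; lia.
case; rewrite subsetD => /andP[SB dSA] cS; split.
  rewrite SB cardsU (eqP (_ : A :&: S == set0)) ?setI_eq0 1?disjoint_sym //.
  by rewrite cards0; lia.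
rewrite setDUl setDv set0U; apply/eqP/setP => x; rewrite !inE.
by case: (boolP (x \in A)) => //= xA; symmetry; apply: contraTF xA => /(disjointFr dSA) ->.
Qed.

Variable R : realFieldType.
Implicit Types (h : {set V} -> R) (S A B : {set V}).

(** The kernel of the down operator, imposed at all cardinalities at once, so that a single [h]
    carries a harmonic function for every level. *)
Definition harmonic h := forall B, \sum_(v | v \notin B) h (v |: B) = 0.

(** For harmonic [h], viewed as a function of [S] on one slice, this lies in the [j]-th eigenspace
    of the Johnson scheme. *)
Definition level j h S : R := \sum_(A : {set V} | (A \subset S) && (#|A| == j)) h A.

Lemma level_small j h S : (#|S| < j)%N -> level j h S = 0.
Proof.
move=> Sj; apply: big_pred0 => A; apply/negP => /andP[/subset_leq_card + /eqP].
lia.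
Qed.

Lemma level0 h S : level 0 h S = h set0.
Proof.
rewrite /level (big_pred1 set0) // => A; rewrite cards_eq0 /=.
by case: eqP => [->|]; rewrite ?sub0set ?andbF.
Qed.

Lemma sum_level h S m : (#|S| < m)%N ->
  \sum_(A : {set V} | A \subset S) h A = \sum_(j < m) level j h S.
Proof.
move=> Sm; rewrite (partition_big (fun A : {set V} => inord #|A| : 'I_m.-1.+1) predT) //=.
case: m Sm => // m Sm; apply: eq_bigr => j _; apply: eq_bigl => A.
case: (boolP (A \subset S)) => //= AS; rewrite -val_eqE /= inordK //.
by have := subset_leq_card AS; lia.
Qed.

(** Induction on [s]: on the slice of size [s.+1], [f] is a residual that is harmonic in top degree
    plus a combination of inclusion functions of [s]-sets. The weights [w] of that combination are
    decomposed by the induction hypothesis. *)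
Lemma harmonic_decomposition (f : {set V} -> R) s :
  exists2 h, harmonic h &
    forall S, #|S| = s -> f S = \sum_(A : {set V} | A \subset S) h A.
Proof.
suff [h Hh [_ E]] : exists2 h, harmonic h & (forall A, (s < #|A|)%N -> h A = 0) /\
    forall S, #|S| = s -> f S = \sum_(A : {set V} | A \subset S) h A by exists h.
elim: s f => [|s IH] f.
  exists (fun A => if A == set0 then f set0 else 0).
    move=> B; apply: big1 => v _.
    by case: eqP => // /setP/(_ v); rewrite !inE eqxx.
  split=> [A|S /cards0_eq ->]; first by case: eqP => // ->; rewrite cards0.
  by rewrite (big_pred1 set0) ?eqxx // => A; rewrite subset0.
(* [K] is the inclusion matrix between the slices of sizes [s] and [s.+1]; [g] below is the residual
   of [f] modulo its rows. *)
pose K B S : R := ((#|S| == s.+1) && (#|B| == s) && (B \subset S))%:R.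
have [w Hw] := normal_equations K f.
have [h Hh [h0 hE]] := IH w.
pose g S := f S - \sum_B w B * K B S.
(* The factor [s.+1 - #|A|] counts the [s]-sets lying between [A] and a given set of size [s.+1]. *)
pose h' A := if (#|A| <= s)%N then (s.+1 - #|A|)%:R * h A
             else if #|A| == s.+1 then g A else 0.
exists h'.
  move=> B; have cU v : v \notin B -> #|v |: B| = #|B|.+1 by move=> vB; rewrite cardsU1 vB.
  case: (ltngtP #|B| s) => Bs.
  - rewrite (eq_bigr (fun v => (s - #|B|)%:R * h (v |: B))); last first.
      by move=> v vB; rewrite /h' cU // Bs subSS.
    by rewrite -mulr_sumr Hh mulr0.
  - by apply: big1 => v vB; rewrite /h' cU // leqNgt ltnS (ltnW Bs) /= eqSS; case: eqP => //; lia.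
  (* At size [s], harmonicity of [h'] is the normal equation for [B]. The flag sum restricted to
     [A :\ v == B] isolates the supersets of this one set. *)
  rewrite -[RHS](Hw B) (eq_bigr (fun v => g (v |: B))); last first.
    by move=> v vB; rewrite /h' cU // Bs ltnn eqxx.
  have := @sum_flag R (fun A v => if A :\ v == B then K B A * g A else 0).
  rewrite [X in _ = X -> _](bigD1 B) //= [X in _ + X]big1 ?addr0; last first.
    by move=> C CB; apply: big1 => v vC; rewrite setU1K // (negPf CB).
  rewrite (eq_bigr (fun v => g (v |: B))); last first.
    by move=> v vB; rewrite setU1K // eqxx /K cU // Bs !eqxx subsetUr mul1r.
  move=> <-; apply: eq_bigr => A _; rewrite -/(g A) -big_mkcondr /=.
  case: (boolP ((#|A| == s.+1) && (#|B| == s) && (B \subset A))); last first.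
    by move=> /negPf E; rewrite /K E mul0r; apply: big1.
  case/andP=> /andP[/eqP cA _] BA.
  have : #|A :\: B| == 1%N by rewrite cardsDS //; lia.
  case/cards1P=> u /setP Du; rewrite (big_pred1 u) // => v /=.
  have := Du u; rewrite !inE eqxx => /andP[uB uA].
  apply/andP/eqP => [[vA /eqP/setP e]|->].
    by apply/eqP; have := Du v; rewrite !inE vA andbT => <-; rewrite -e !inE eqxx.
  split=> //; apply/eqP/setP => x; have := Du x; rewrite !inE.
  case: (boolP (x \in B)) => [xB _|_] /=; last by case: eqP => //= _ ->.
  by rewrite (subsetP BA) // andbT; apply: contraNneq uB => <-.
split=> [A sA|S cS]; first by rewrite /h' !ifN //; lia.
have hS : \sum_(A : {set V} | A \subset S) h' A =
    \sum_(A : {set V} | A \subset S) (s.+1 - #|A|)%:R * h A + g S.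
  rewrite (bigD1 S) //= [X in _ = X + _](bigD1 S) //=.
  rewrite /h' cS ltnn eqxx subnn mul0r add0r addrC; congr (_ + _).
  apply: eq_bigr => A /andP[AS nAS]; rewrite ifT // -ltnS -cS proper_card //.
  by rewrite properEneq nAS.
rewrite hS /g addrCA -[LHS]addr0; congr (_ + _); apply/esym/eqP; rewrite subr_eq0.
rewrite [X in _ == X](eq_bigr (fun B => if (B \subset S) && (#|B| == s)
    then \sum_(A : {set V} | A \subset B) h A else 0)); last first.
  move=> B _; rewrite /K /= cS eqxx /= andbC.
  by case: ifP => [/andP[_ /eqP /hE ->]|_]; rewrite ?mulr1 ?mulr0.
rewrite -big_mkcond /= (exchange_big_dep (fun A : {set V} => A \subset S)) /=; last first.
  by move=> B A /andP[BS _] AB; apply: subset_trans BS.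
apply/eqP/eq_bigr => A AS.
have [sA|As] := ltnP s #|A|.
  by rewrite h0 // mulr0 big1.
rewrite sumr_const mulr_natl; congr (_ *+ _).
have := card_between (s - #|A|) AS.
rewrite subnK // cS subSn // binSn => <-; rewrite cardsE; apply: eq_card => B.
by rewrite -!topredE /=; case: (A \subset B); rewrite ?andbF ?andbT.
Qed.
End Subsets.

(** * Disjointness and the levels of a slice *)

(** Separates eigenvalues by absolute value, so that their alternating signs need no case analysis
    later. *)
Lemma sign_mul_inj (R : realFieldType) (a b x : R) (i j : nat) :
  (-1) ^+ j * b * x = (-1) ^+ i * a * x -> b < a -> 0 <= b -> x = 0.
Proof.
rewrite -!mulrA -(signr_odd _ i) -(signr_odd _ j) => E ba b0.
have : (a - b) * x = 0 \/ (a + b) * x = 0.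
  rewrite mulrBl mulrDl; move: (a * x) (b * x) E => y z.
  by case: (odd i); case: (odd j); rewrite ?expr0 ?expr1 ?mulN1r ?mul1r => E;
     [left|right|right|left]; lra.
by case=> /eqP; rewrite mulf_eq0 => /orP[|/eqP //]; rewrite gt_eqF //; lra.
Qed.

Section Levels.
Variables (V : finType) (R : realFieldType).
Local Notation n := #|V|.
Implicit Types (h : {set V} -> R) (S A B : {set V}).

(** Sum the harmonic relation over all [B] of size [j - 1] meeting [S] in [i] points. A set [A]
    arises from such a [B] in [i.+1] ways if it meets [S] in [i.+1] points (the removed point is in
    [S]), and in [j - i] ways if it meets [S] in [i] points. *)
Lemma harmonic_meet_sum h S i j : harmonic h -> (i < j)%N ->
  i.+1%:R * (\sum_(A : {set V} | (#|A| == j) && (#|A :&: S| == i.+1)) h A) =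
  - (j - i)%:R * (\sum_(A : {set V} | (#|A| == j) && (#|A :&: S| == i)) h A).
Proof.
move=> Hh ij.
have := @sum_flag V R (fun A v =>
  if (#|A| == j) && (#|(A :\ v) :&: S| == i) then h A else 0).
rewrite [X in _ = X -> _]big1 => [|B _]; last first.
  case: (boolP ((#|B|.+1 == j) && (#|B :&: S| == i))) => E.
    rewrite -[RHS](Hh B); apply: eq_bigr => v vB.
    by rewrite setU1K // cardsU1 vB E.
  by apply: big1 => v vB; rewrite setU1K // cardsU1 vB (negPf E).
move=> E; apply/eqP; rewrite mulNr -addr_eq0; apply/eqP; apply: etrans E.
rewrite !mulr_sumr [X in X + _]big_mkcond [X in _ + X]big_mkcond -big_split /=.
apply: eq_bigr => A _; case: (boolP (#|A| == j)) => [/eqP Aj|_] /=; last first.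
  by rewrite addr0 big1.
rewrite -big_mkcondr /=.
rewrite (eq_bigl [in [set v in A | #|(A :\ v) :&: S| == i]]); last first.
  by move=> v; rewrite !inE.
rewrite sumr_const (_ : #|[set v in A | _]| = (if #|A :&: S| == i.+1 then i.+1 else 0) +
   (if #|A :&: S| == i then j - i else 0))%N; last first.
  have cD v : v \in A -> #|(A :\ v) :&: S| = (#|A :&: S| - (v \in S))%N.
    by move=> vA; rewrite setIDAC (cardsD1 v (A :&: S)) !inE vA /= addKn.
  rewrite -[LHS]sum1_card (bigID (mem S)) /= !sum1dep_card; congr (_ + _)%N.
    case: (boolP (#|A :&: S| == i.+1)) => [/eqP E|E]; last first.
      apply: eq_card0 => v; rewrite !inE; apply/negP => /andP[/andP[vA]].
      rewrite cD // => + vS; rewrite vS.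
      have : (0 < #|A :&: S|)%N by apply/card_gt0P; exists v; rewrite inE vA.
      lia.
    rewrite -E; apply: eq_card => v; rewrite !inE.
    case: (boolP (v \in A)) => //= vA; rewrite cD //.
    by case: (v \in S); rewrite ?andbF // E subn1 eqxx.
  case: (boolP (#|A :&: S| == i)) => [/eqP E|E]; last first.
    apply: eq_card0 => v; rewrite !inE; apply/negP => /andP[/andP[vA]].
    by rewrite cD // => /[swap] /negPf ->; rewrite subn0 (negPf E).
  rewrite -E -Aj -cardsDS ?subsetIl //; apply: eq_card => v.
  rewrite !inE.
  case: (boolP (v \in A)) => //= vA; rewrite cD ?andbT //.
  by case: (v \in S); rewrite ?andbF // subn0 eqxx.
by rewrite mulrnDr !mulr_natl; do 2!case: ifP => _; rewrite ?mulr0n.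
Qed.

(** Iterating the recurrence on the size of [A :&: S] links its two extremes: size [0] is
    disjointness and size [j] is inclusion in [S]. *)
Lemma harmonic_disjoint_sum h S (j : nat) : harmonic h ->
  \sum_(A : {set V} | [disjoint A & S] && (#|A| == j)) h A = (-1) ^+ j * level j h S.
Proof.
move=> Hh.
pose N i := \sum_(A : {set V} | (#|A| == j) && (#|A :&: S| == i)) h A.
have NE i : (i <= j)%N -> N i = (-1) ^+ i * 'C(j, i)%:R * N 0.
  elim: i => [|i IH] ij; first by rewrite bin0 !mul1r.
  have /eqP := harmonic_meet_sum S Hh ij; rewrite -/(N i.+1) -/(N i) IH; last lia.
  have i0 : (i.+1%:R : R) != 0 by rewrite pnatr_eq0.
  move=> /eqP E; apply: (mulfI i0); rewrite E.
  have := congr1 (fun m => m%:R : R) (mul_bin_left j i); rewrite !natrM exprS => E2.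
  transitivity (- (-1) ^+ i * ((j - i)%:R * 'C(j, i)%:R) * N 0); first by ring.
  by rewrite -E2; ring.
have -> : level j h S = N j.
  apply: eq_bigl => A; rewrite andbC; case: eqP => //= Aj.
  apply/idP/eqP => [/setIidPl -> //|E].
  by apply/setIidPl/eqP; rewrite eqEcard subsetIl Aj E /=.
rewrite NE // binn mulr1 mulrA -expr2 sqrr_sign mul1r.
by apply: eq_bigl => A; rewrite andbC cards_eq0 setI_eq0.
Qed.

(** Levels are eigenvectors of disjointness: exchange the sums and count the [S'] around a fixed
    [A]. The lower index [n - #|S| - s], instead of [s - j], makes the scalar vanish for [j > s];
    this is where the inequality [s + #|S| < n] has to be strict. *)
Lemma level_disjoint_sum h S (s j : nat) : harmonic h -> (s + #|S| < n)%N ->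
  \sum_(S' : {set V} | [disjoint S' & S] && (#|S'| == s)) level j h S' =
  (-1) ^+ j * 'C(n - #|S| - j, n - #|S| - s)%:R * level j h S.
Proof.
move=> Hh sS; rewrite (exchange_big_dep
  (fun A : {set V} => [disjoint A & S] && (#|A| == j))) /=; last first.
  move=> S' A /andP[dS _] /andP[AS ->]; rewrite andbT.
  exact: disjointWl dS.
rewrite -mulrA mulrCA -harmonic_disjoint_sum // mulr_sumr.
apply: eq_bigr => A /andP[dAS /eqP Aj]; rewrite sumr_const mulr_natl.
congr (_ *+ _).
have AC : A \subset ~: S by rewrite subsets_disjoint setCK.
have [js|sj] := leqP j s; last first.
  rewrite bin_small; last first.
    by move: sj sS; rewrite -Aj; move: #|_| #|_| #|_| => a b c; lia.
  apply: eq_card0 => S'; rewrite -topredE /=; apply/negP.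
  by case/andP=> /andP[_ /eqP cS'] /andP[/subset_leq_card]; lia.
have := card_between (s - j) AC; have cC := cardsC S; have le := subset_leq_card AC.
rewrite (_ : #|~: S| - #|A| = n - #|S| - j)%N; last by lia.
rewrite -(@bin_sub (n - #|S| - j) (n - #|S| - s)); last by lia.
rewrite (_ : _ - _ - (n - #|S| - s) = s - j)%N; last by lia.
move=> <-; rewrite cardsE; apply: eq_card => S'; rewrite -!topredE /= Aj eqxx andbT.
by rewrite subnK // (subsets_disjoint S') setCK; case: (A \subset S'); rewrite ?andbF ?andbT.
Qed.

Definition dot s (u v : {set V} -> R) := \sum_(S : {set V} | #|S| == s) u S * v S.

Lemma disjoint_sum_sym s t (u v : {set V} -> R) :
  \sum_(S : {set V} | #|S| == s) \sum_(S' : {set V} | [disjoint S' & S] && (#|S'| == t)) u S * v S' =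
  \sum_(S' : {set V} | #|S'| == t) \sum_(S : {set V} | [disjoint S & S'] && (#|S| == s)) u S * v S'.
Proof.
rewrite (exchange_big_dep (fun S' : {set V} => #|S'| == t)) /=; last by move=> S S' _ /andP[].
apply: eq_bigr => S' /eqP cS'; apply: eq_bigl => S.
by rewrite cS' eqxx andbT disjoint_sym andbC.
Qed.

Lemma disjoint_sum_levelr h' (s t j : nat) (u : {set V} -> R) :
  harmonic h' -> (s + t < n)%N ->
  \sum_(S : {set V} | #|S| == s) \sum_(S' : {set V} | [disjoint S' & S] && (#|S'| == t)) u S * level j h' S' =
  (-1) ^+ j * 'C(n - s - j, n - s - t)%:R * dot s u (level j h').
Proof.
move=> Hh st; rewrite mulr_sumr; apply: eq_bigr => S /eqP cS.
by rewrite -mulr_sumr level_disjoint_sum ?cS 1?addnC //; ring.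
Qed.

(** The disjointness form between the slices [s] and [t] is evaluated from either side. For [i = j]
    it compares the inner products of the same level on the two slices. *)
Lemma dot_level_exchange h h' (s t i j : nat) : harmonic h -> harmonic h' -> (s + t < n)%N ->
  (-1) ^+ j * 'C(n - s - j, n - s - t)%:R * dot s (level i h) (level j h') =
  (-1) ^+ i * 'C(n - t - i, n - t - s)%:R * dot t (level i h) (level j h').
Proof.
move=> Hh Hh' st; rewrite -disjoint_sum_levelr // disjoint_sum_sym mulr_sumr.
apply: eq_bigr => S /eqP cS.
by rewrite -mulr_suml level_disjoint_sum ?cS //; ring.
Qed.

(* Disjointness of two sets of size s is a symmetric relation, so the operator it
   defines is self-adjoint; distinct levels have distinct eigenvalues. *)
Lemma level_orthogonal h h' (s i j : nat) : harmonic h -> harmonic h' -> (s.*2 < n)%N ->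
  i != j -> dot s (level i h) (level j h') = 0.
Proof.
wlog ij : h h' i j / (i < j)%N => [W Hh Hh' sn|Hh Hh' sn _].
  case: (ltngtP i j) => // ij _; first by apply: W; rewrite // neq_ltn ij.
  rewrite -(W h' h j i) ?neq_ltn ?ij //.
  by apply: eq_bigr => S _; rewrite mulrC.
(* Beyond [s] the eigenvalues are all zero and separate nothing, but there the level itself
   vanishes. *)
have [js|sj] := leqP j s; last first.
  by apply: big1 => S /eqP cS; rewrite (@level_small _ _ j) ?cS // mulr0.
have := @dot_level_exchange h h' s s i j Hh Hh'; rewrite addnn => /(_ sn) E.
have lt : ('C(n - s - j, n - s - s) < 'C(n - s - i, n - s - s))%N.
  have -> : (n - s - i = (n - s - j) + (j - i))%N by lia.
  have : (0 < j - i)%N by lia.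
  have : (0 < n - s - s <= n - s - j)%N by lia.
  case: (n - s - s)%N => // m /andP[_ mj]; case: (j - i)%N => // r _.
  rewrite addnS binS; have : (0 < 'C(n - s - j + r, m))%N by rewrite bin_gt0; lia.
  have : ('C(n - s - j, m.+1) <= 'C(n - s - j + r, m.+1))%N by apply: leq_bin2l; lia.
  lia.
have {}lt : ('C(n - s - j, n - s - s)%:R < 'C(n - s - i, n - s - s)%:R :> R).
  by rewrite ltr_nat.
have ge0 : (0 <= 'C(n - s - j, n - s - s)%:R :> R) by rewrite ler0n.
exact: sign_mul_inj E lt ge0.
Qed.
End Levels.

(** * Lower bound for the partition form *)

(** Each unit of [j] multiplies the binomial by [(m - j - s) / (m - j)], at most [1 - s / m], hence
    at most [51/100]. *)
Lemma bin_decay (m s j : nat) : (0 < s)%N -> (49 * m <= 100 * s)%N ->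
  (100 ^ j * 'C(m - j, s) <= 51 ^ j * 'C(m, s))%N.
Proof.
move=> s0 ms; elim: j => [|j IH]; first by rewrite subn0.
have [mj|mj] := leqP m j; first by rewrite bin_small ?muln0 //; lia.
rewrite !expnS -!mulnA; apply: leq_trans (leq_mul (leqnn 51) IH).
rewrite mulnCA [leqRHS]mulnCA leq_mul2l; apply/orP; right.
rewrite -(@leq_pmul2l (m - j)) ?subn_gt0 // [leqLHS]mulnCA.
have := mul_bin_down (m - j) s; rewrite -subnS => ->.
by rewrite !mulnA leq_mul2r; apply/orP; right; lia.
Qed.

(** The exponent [i] is independent of [j], so that the fixed powers 2 and 3 serve for all higher
    levels. *)
Lemma bin_decay_le (R : realFieldType) (m s i j : nat) : (0 < s)%N ->
  (49 * m <= 100 * s)%N -> (i <= j)%N ->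
  'C(m - j, s)%:R <= (51 / 100) ^+ i * 'C(m, s)%:R :> R.
Proof.
move=> s0 ms ij; apply: (@le_trans _ _ 'C(m - i, s)%:R).
  by rewrite ler_nat leq_bin2l //; lia.
rewrite expr_div_n mulrAC ler_pdivlMr ?exprn_gt0 ?ltr0n // mulrC -!natrX -!natrM ler_nat.
exact: bin_decay.
Qed.

Lemma quadratic_form_ge0 (R : realFieldType) (a b c F G : R) :
  0 < a -> b ^+ 2 <= a * c -> 0 <= a * F ^+ 2 + 2 * b * F * G + c * G ^+ 2.
Proof.
move=> a0 bac; rewrite -(pmulr_rge0 _ a0).
have -> : a * (a * F ^+ 2 + 2 * b * F * G + c * G ^+ 2) =
  (a * F + b * G) ^+ 2 + (a * c - b ^+ 2) * G ^+ 2 by ring.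
by rewrite addr_ge0 ?sqr_ge0 // mulr_ge0 ?sqr_ge0 // subr_ge0.
Qed.

Section Bound.
Variables (V : finType) (R : realFieldType).
Local Notation n := #|V|.
Implicit Types (h : {set V} -> R) (S A B : {set V}).

Lemma dot_ge0 s (u : {set V} -> R) : 0 <= dot s u u.
Proof. by apply: sumr_ge0 => S _; rewrite -expr2 sqr_ge0. Qed.

Lemma card_slice s : #|[set S : {set V} | #|S| == s]| = 'C(n, s).
Proof. by rewrite card_draws. Qed.

Lemma dot_level0 h h' s :
  dot s (level 0 h) (level 0 h') = 'C(n, s)%:R * (h set0 * h' set0).
Proof.
rewrite /dot (eq_bigr (fun=> h set0 * h' set0)); last by move=> S _; rewrite !level0.
rewrite -card_slice mulr_natl -sumr_const; apply: eq_bigl => S; by rewrite inE.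
Qed.

Definition mean s (u : {set V} -> R) := (\sum_(S : {set V} | #|S| == s) u S) / 'C(n, s)%:R.

(** Orthogonality of the levels turns the harmonic decomposition into Fourier coefficients and a
    Parseval identity. The index runs up to [n] whatever [s] is, so that expansions on two slices
    can be added termwise. *)
Lemma slice_decomposition (u : {set V} -> R) s : (s.*2 < n)%N ->
  exists2 h, harmonic h &
    [/\ h set0 = mean s u,
        forall S, #|S| = s -> u S = \sum_(j < n.+1) level j h S,
        forall h' (j : nat), harmonic h' ->
          dot s u (level j h') = dot s (level j h) (level j h') &
        dot s u u = \sum_(j < n.+1) dot s (level j h) (level j h)].
Proof.
move=> sn; have [h Hh hE] := harmonic_decomposition u s; exists h => //.
have uE S : #|S| = s -> u S = \sum_(j < n.+1) level j h S.
  by move=> cS; rewrite hE // -sum_level // ltnS max_card.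
have dotE v : dot s u v = \sum_(j < n.+1) dot s (level j h) v.
  rewrite /dot exchange_big /=; apply: eq_bigr => S /eqP cS.
  by rewrite uE // mulr_suml.
have orth h' (j : nat) : harmonic h' -> dot s u (level j h') = dot s (level j h) (level j h').
  move=> Hh'; rewrite dotE; have [jn|nj] := ltnP j n.+1.
    rewrite (bigD1 (Ordinal jn)) //= big1 ?addr0 // => i /= ij.
    by apply: level_orthogonal => //; rewrite -val_eqE in ij.
  have z v : dot s v (level j h') = 0.
    by apply: big1 => S /eqP cS; rewrite (@level_small _ _ j) ?mulr0 // cS; lia.
  by rewrite z big1.
split=> //.
  (* The level [0] of [d] is the constant function 1, so pairing [u] with it gives the mean. *)
  pose d A : R := (A == set0)%:R.
  have Hd : harmonic d.
    move=> B; apply: big1 => v _; rewrite /d.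
    by case: eqP => // /setP/(_ v); rewrite !inE eqxx.
  have := orth d 0 Hd; rewrite dot_level0 {2}/d eqxx mulr1 /mean.
  rewrite /dot (eq_bigr u); last by move=> S _; rewrite level0 /d eqxx mulr1.
  move=> ->; rewrite mulrC mulKf //.
  by rewrite pnatr_eq0 -lt0n bin_gt0; lia.
rewrite dotE; apply: eq_bigr => j _; rewrite -orth //.
by apply: eq_bigr => S _; rewrite mulrC.
Qed.

(** If the sum of [u] over the sets containing [v] does not depend on [v], then pairing [u] with
    level 1 gives that common value times the total of [h] over singletons, which is zero by
    harmonicity. The level 1 component is then orthogonal to itself. *)
Lemma level1_eq0 (u : {set V} -> R) h s : harmonic h ->
  dot s u (level 1 h) = dot s (level 1 h) (level 1 h) ->
  (forall v w, \sum_(S : {set V} | (#|S| == s) && (v \in S)) u S =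
               \sum_(S : {set V} | (#|S| == s) && (w \in S)) u S) ->
  forall S, #|S| = s -> level 1 h S = 0.
Proof.
move=> Hh orth tr.
have total0 : \sum_(A : {set V} | #|A| == 1) h A = 0.
  have := harmonic_disjoint_sum set0 1 Hh.
  rewrite level_small ?cards0 // mulr0 => E; apply: etrans E; apply: eq_bigl => A.
  by rewrite -setI_eq0 setI0 eqxx.
have dot0 : dot s u (level 1 h) = 0.
  rewrite /dot /level; under eq_bigr do rewrite mulr_sumr.
  rewrite (exchange_big_dep (fun A : {set V} => #|A| == 1)) /=; last by move=> S A _ /andP[].
  have [v _|V0] := pickP (pred_of_simpl (@predT V)); last first.
    by apply: big1 => A /cards1P[v]; have := V0 v.
  transitivity ((\sum_(S : {set V} | (#|S| == s) && (v \in S)) u S) *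
    \sum_(A : {set V} | #|A| == 1) h A); last by rewrite total0 mulr0.
  rewrite mulr_sumr; apply: eq_bigr => A /cards1P[w ->]; rewrite (tr v w) mulr_suml; apply: eq_bigl => S.
  by rewrite sub1set cards1 andbT.
move=> S /eqP cS; move: orth; rewrite dot0 => /esym orth.
have {}orth : \sum_(S : {set V} | #|S| == s) level 1 h S ^+ 2 = 0.
  by rewrite -[RHS]orth; apply: eq_bigr => S' _; rewrite expr2.
have /eqP := psumr_eq0P (fun S' _ => sqr_ge0 (level 1 h S')) orth cS.
by rewrite sqrf_eq0 => /eqP.
Qed.

Section Partition.
Variables (s t : nat).
Hypotheses (s0 : (0 < s)%N) (t0 : (0 < t)%N) (nE : n = (s + s + t)%N).
Hypotheses (hs : (49 * (s + t) <= 100 * s)%N) (ht : (49 * (s + t) <= 100 * t)%N).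
Local Notation N := ('C(s + t, s)%:R : R).
Local Notation M := ('C(s + s, s)%:R : R).

(* The weights 1/5 and 2/5 leave room in both parities: with r = 51/100 bounding
   the eigenvalue ratios, r^4 <= 1/5 * 2/5 for even j >= 2 and
   r^6 <= (1/5 - r^3) * 2/5 for odd j >= 3. *)
Lemma level_form_ge0 h h' (j : nat) : harmonic h -> harmonic h' -> (2 <= j)%N ->
  0 <= (-1) ^+ j * ('C(s + t - j, t)%:R * dot s (level j h) (level j h) +
                    2 * 'C(s + t - j, s)%:R * dot s (level j h) (level j h'))
     + N / 5 * dot s (level j h) (level j h)
     + 2 / 5 * M * dot t (level j h') (level j h').
Proof.
move=> Hh Hh' j2.
have N0 : 0 < N by rewrite ltr0n bin_gt0 leq_addr.
have M0 : 0 < M by rewrite ltr0n bin_gt0 leq_addr.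
have E : 'C(s + t - j, s)%:R * dot s (level j h') (level j h') =
    'C(s + s - j, s)%:R * dot t (level j h') (level j h').
  have sg : (-1) ^+ j != 0 :> R by rewrite signr_eq0.
  have st : (s + t < n)%N by lia.
  have := dot_level_exchange j j Hh' Hh' st.
  rewrite (_ : n - s - j = s + t - j)%N; last by lia.
  rewrite (_ : n - s - t = s)%N; last by lia.
  rewrite (_ : n - t - j = s + s - j)%N; last by lia.
  rewrite (_ : n - t - s = s)%N; last by lia.
  by rewrite -!mulrA => /(mulfI sg).
have [js|sj] := leqP j s; last first.
  have dot0 u : dot s (level j h) u = 0.
    by apply: big1 => S /eqP cS; rewrite level_small ?cS // mul0r.
  by rewrite !dot0 !(mulr0, addr0, add0r) mulr_ge0 ?dot_ge0 //; lra.
set e := 'C(s + t - j, t)%:R; set c := 'C(s + t - j, s)%:R in E *.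
set c' := 'C(s + s - j, s)%:R in E.
have c'0 : 0 < c' by rewrite ltr0n bin_gt0; lia.
have c0 : 0 <= c by rewrite ler0n.
have e0 : 0 <= e by rewrite ler0n.
have NE : 'C(s + t, t)%:R = N :> R by rewrite -bin_sub ?leq_addl // addnK.
have c_le i : (i <= j)%N -> c <= (51 / 100) ^+ i * N by apply: bin_decay_le.
have e_le i : (i <= j)%N -> e <= (51 / 100) ^+ i * N by rewrite -NE; apply: bin_decay_le.
have c'_le i : (i <= j)%N -> c' <= (51 / 100) ^+ i * M by apply: bin_decay_le => //; lia.
have [K0 cK] : 0 < N / 5 + (-1) ^+ j * e /\ c * c' <= (N / 5 + (-1) ^+ j * e) * (2 / 5 * M).
  rewrite -signr_odd; case: (boolP (odd j)) => oj.
    have j3 : (3 <= j)%N by rewrite ltn_neqAle j2 andbT; apply: contraTneq oj => <-.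
    have := e_le 3 j3; have := c_le 3 j3; have := c'_le 3 j3.
    rewrite expr1 mulN1r => c'3 c3 e3; split; first by lra.
    apply: (le_trans (ler_pM c0 (ltW c'0) c3 c'3)).
    (* [673/10000] is [1/5 - (51/100)^3] rounded down. *)
    apply: (@le_trans _ _ ((673 / 10000) * N * (2 / 5 * M))).
      rewrite -subr_ge0; have := mulr_gt0 N0 M0; lra.
    by rewrite ler_pM2r; lra.
  have := e_le 2 j2; have := c_le 2 j2; have := c'_le 2 j2.
  rewrite expr0 mul1r => c'2 c2 e2; split; first by lra.
  apply: (le_trans (ler_pM c0 (ltW c'0) c2 c'2)).
  apply: (@le_trans _ _ (N / 5 * (2 / 5 * M))).
    rewrite -subr_ge0; have := mulr_gt0 N0 M0; lra.
  by rewrite ler_pM2r; lra.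
(* After multiplication by [c'], [E] turns the norm on slice [t] into one on slice [s], and the form
   becomes a sum of pointwise binary quadratic forms over a single slice. *)
rewrite -(pmulr_rge0 _ c'0).
have -> : c' * ((-1) ^+ j * (e * dot s (level j h) (level j h) +
      2 * c * dot s (level j h) (level j h')) + N / 5 * dot s (level j h) (level j h)
     + 2 / 5 * M * dot t (level j h') (level j h')) =
   \sum_(S : {set V} | #|S| == s) (c' * (N / 5 + (-1) ^+ j * e) * level j h S ^+ 2 +
     2 * ((-1) ^+ j * c * c') * level j h S * level j h' S +
     (2 / 5 * M * c) * level j h' S ^+ 2).
  transitivity (c' * (N / 5 + (-1) ^+ j * e) * dot s (level j h) (level j h) +
     2 * ((-1) ^+ j * c * c') * dot s (level j h) (level j h') +
     2 / 5 * M * (c' * dot t (level j h') (level j h'))); first by ring.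
  rewrite -E /dot !mulr_sumr -!big_split /=; apply: eq_bigr => S _; ring.
apply: sumr_ge0 => S _; apply: quadratic_form_ge0; first exact: mulr_gt0.
rewrite !exprMn sqrr_sign mul1r !expr2.
have -> : c * c * (c' * c') = c * c' * (c * c') by ring.
have -> : c' * (N / 5 + (-1) ^+ j * e) * (2 / 5 * M * c) =
  (c * c') * ((N / 5 + (-1) ^+ j * e) * (2 / 5 * M)) by ring.
by rewrite ler_wpM2l // mulr_ge0 // ltW.
Qed.

(** Expand [u] on both slices. Level 0 gives the left-hand side, with [6/5 = 1 + 1/5]; the other
    levels contribute nonnegatively. *)
Lemma partition_form_bound (u : {set V} -> R) :
  (forall v w, \sum_(S : {set V} | (#|S| == s) && (v \in S)) u S =
               \sum_(S : {set V} | (#|S| == s) && (w \in S)) u S) ->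
  N * 'C(n, s)%:R * (6 / 5 * mean s u ^+ 2 + 2 * mean s u * mean t u) +
    2 / 5 * M * 'C(n, t)%:R * mean t u ^+ 2 <=
  \sum_(S : {set V} | #|S| == s) \sum_(S' : {set V} | [disjoint S' & S] && (#|S'| == s)) u S * u S' +
  2 * (\sum_(S : {set V} | #|S| == s) \sum_(S' : {set V} | [disjoint S' & S] && (#|S'| == t)) u S * u S') +
  N / 5 * dot s u u + 2 / 5 * M * dot t u u.
Proof.
move=> tr.
have sn : (s.*2 < n)%N by lia.
have tn : (t.*2 < n)%N by lia.
have nss : (n - s - s = t)%N by lia.
have nst : (n - s - t = s)%N by lia.
have ns : (n - s = s + t)%N by lia.
have [h Hh [h0 hE hdot hnorm]] := slice_decomposition u sn.
have [g Hg [g0 gE gdot gnorm]] := slice_decomposition u tn.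
have F1 S : #|S| = s -> level 1 h S = 0 by apply: (level1_eq0 Hh _ tr); apply: hdot.
have -> : \sum_(S : {set V} | #|S| == s)
    \sum_(S' : {set V} | [disjoint S' & S] && (#|S'| == s)) u S * u S' =
    \sum_(j < n.+1) (-1) ^+ j * 'C(s + t - j, t)%:R * dot s (level j h) (level j h).
  under eq_bigr => S _.
    under eq_bigr => S' /andP[_ /eqP cS'] do rewrite (hE S' cS') mulr_sumr.
    rewrite exchange_big; over.
  rewrite exchange_big /=; apply: eq_bigr => j _.
  rewrite disjoint_sum_levelr //; last lia.
  by rewrite nss ns hdot.
have -> : \sum_(S : {set V} | #|S| == s)
    \sum_(S' : {set V} | [disjoint S' & S] && (#|S'| == t)) u S * u S' =
    \sum_(j < n.+1) (-1) ^+ j * 'C(s + t - j, s)%:R * dot s (level j h) (level j g).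
  under eq_bigr => S _.
    under eq_bigr => S' /andP[_ /eqP cS'] do rewrite (gE S' cS') mulr_sumr.
    rewrite exchange_big; over.
  rewrite exchange_big /=; apply: eq_bigr => j _.
  rewrite disjoint_sum_levelr //; last lia.
  by rewrite nst ns hdot.
rewrite hnorm gnorm !mulr_sumr -!big_split /= big_ord_recl /= !subn0 expr0 !dot_level0 h0 g0.
have -> : 'C(s + t, t)%:R = N by rewrite -bin_sub ?leq_addl // addnK.
rewrite -[leLHS]addr0; apply: lerD.
  by rewrite le_eqVlt; apply/orP; left; apply/eqP; field.
apply: sumr_ge0 => i _; rewrite /bump /= add1n.
case: i => -[|j] /= jn.
  (* At level 1 the component on slice [s] vanishes by transitivity, which leaves only a norm on
     slice [t]. *)
  have dot0 v : dot s (level 1 h) v = 0.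
    by apply: big1 => S /eqP cS; rewrite F1 // mul0r.
  rewrite !dot0 !(mulr0, add0r); have := dot_ge0 t (level 1 g); have M0 : 0 <= M by rewrite ler0n.
  by move=> G1; rewrite mulr_ge0 //; lra.
apply: le_trans (level_form_ge0 Hh Hg (_ : 2 <= j.+2)%N) _ => //.
rewrite le_eqVlt; apply/orP; left; apply/eqP; ring.
Qed.
End Partition.
End Bound.

(** * The minority bound *)

Lemma minority_arith (R : realFieldType) (p q y : R) :
  0 <= p -> 0 <= q -> p + q <= 1 -> y <= p - q ->
  6 / 5 * y ^+ 2 + 2 * y * (p - q) + 2 / 5 * (p - q) ^+ 2 + 2 / 5 * (p + q) <= 0 ->
  q <= 1 / 50.
Proof.
move=> p0 q0 pq1 yx E; set x := p - q in yx E.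
(* Completing the square in [y] leaves [2/5 - 5/6 = -13/30] as the coefficient of [x ^+ 2]. *)
have x2 : 12 / 13 * (p + q) <= x ^+ 2.
  have := sqr_ge0 (y + 5 / 6 * x); rewrite !expr2 in E *; nra.
have x0 : 0 <= x.
  rewrite leNgt; apply/negP => xn; have : 0 < y * x by nra.
  have := sqr_ge0 x; have := sqr_ge0 y; rewrite -!mulrA in E *; lra.
rewrite leNgt; apply/negP => qb.
(* If [q > 1/50] then [x <= 1 - 2 * q < 48/50]. Together with [x2] this yields [q <= p / 51], a
   contradiction. *)
have : x ^+ 2 <= 48 / 50 * x by rewrite expr2 ler_wpM2r // /x; lra.
rewrite /x in x2 *; lra.
Qed.

Section Minority.
Variables (V : finType) (R : realFieldType).
Local Notation n := #|V|.
Implicit Types (u : {set V} -> R) (S A B : {set V}).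

(** The local LYM argument: compare [u] along all flags between the two slices. *)
Lemma mean_antitoneS u s : (forall A B, A \subset B -> u B <= u A) -> (s < n)%N ->
  mean s.+1 u <= mean s u.
Proof.
move=> anti sn.
have [b0 b1] : ('C(n, s) > 0 /\ 'C(n, s.+1) > 0)%N by rewrite !bin_gt0; lia.
have b : s.+1%:R * 'C(n, s.+1)%:R = (n - s)%:R * 'C(n, s)%:R :> R.
  by rewrite -!natrM mul_bin_left.
rewrite {1}/mean ler_pdivrMr ?ltr0n // -(ler_pM2l (_ : 0 < s.+1%:R)) ?ltr0n //.
rewrite mulrCA b mulrCA /mean divfK ?lt0r_neq0 ?ltr0n //.
have := @sum_flag V R (fun B _ => if #|B| == s.+1 then u B else 0).
have -> : \sum_(A : {set V}) \sum_(v in A) (if #|A| == s.+1 then u A else 0) =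
   s.+1%:R * \sum_(S : {set V} | #|S| == s.+1) u S.
  rewrite mulr_sumr [RHS]big_mkcond; apply: eq_bigr => A _.
  by rewrite sumr_const; case: eqP => [->|_]; rewrite ?mul0rn // mulr_natl.
move=> ->; rewrite mulr_sumr [leRHS]big_mkcond; apply: ler_sum => A _.
have [/eqP cA|cA] := boolP (#|A| == s); last first.
  by rewrite big1 // => v vA; rewrite cardsU1 vA eqSS (negPf cA).
have -> : (n - s)%N = #|[pred v | v \notin A]|.
  by rewrite -(cardC A) cA addKn; apply: eq_card => v; rewrite !inE.
rewrite mulr_natl -sumr_const; apply: ler_sum => v /= vA.
by rewrite cardsU1 vA cA eqxx; apply/anti/subsetUr.
Qed.

Lemma mean_antitone u s r : (forall A B, A \subset B -> u B <= u A) -> (s <= r <= n)%N ->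
  mean r u <= mean s u.
Proof.
move=> anti /andP[]; elim: r => [|r IH] sr rn; first by case: s sr.
have [->//|nsr] := eqVneq s r.+1.
by apply: le_trans (IH _ _); first apply: mean_antitoneS => //; lia.
Qed.

Section Partition.
Variables (s t : nat).
Hypothesis (nE : n = (s + s + t)%N).
Local Notation N := ('C(s + t, s)%:R : R).
Local Notation M := ('C(s + s, s)%:R : R).

Lemma card_disjoint S r :
  #|[set S' : {set V} | [disjoint S' & S] && (#|S'| == r)]| = 'C(n - #|S|, r).
Proof.
have -> : (n - #|S| = #|~: S|)%N by have := cardsC S; lia.
rewrite -cards_draws; apply: eq_card => S'; rewrite !inE.
by rewrite subsets_disjoint setCK.
Qed.

Lemma sum_disjoint_const r r' u :
  \sum_(S : {set V} | #|S| == r)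
    \sum_(S' : {set V} | [disjoint S' & S] && (#|S'| == r')) u S =
  'C(n - r, r')%:R * \sum_(S : {set V} | #|S| == r) u S.
Proof.
rewrite mulr_sumr; apply: eq_bigr => S /eqP cS; rewrite -cS -card_disjoint.
by rewrite mulr_natl -sumr_const; apply: eq_bigl => S'; rewrite inE.
Qed.

(** Taking the complement in [~: S] matches the [s]-sets disjoint from [S] with the [t]-sets
    disjoint from [S]. *)
Lemma sum_third S (G : {set V} -> R) : #|S| = s ->
  \sum_(S' : {set V} | [disjoint S' & S] && (#|S'| == s)) G (~: (S :|: S')) =
  \sum_(S' : {set V} | [disjoint S' & S] && (#|S'| == t)) G S'.
Proof.
move=> cS; rewrite [RHS](reindex_onto (fun S' => ~: (S :|: S')) (fun S' => ~: (S :|: S'))).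
  apply: eq_bigl => S'.
  have -> : [disjoint ~: (S :|: S') & S].
    by rewrite -setI_eq0; apply/eqP/setP => x; rewrite !inE; case: (x \in S); rewrite ?andbF.
  apply/andP/andP.
    case=> dS /eqP c'; have := cardsC (S :|: S').
    rewrite cardsU (eqP (_ : S :&: S' == set0)) ?setI_eq0 1?disjoint_sym // cards0 => E.
    split; first by lia.
    apply/eqP/setP => x; rewrite !inE; case: (boolP (x \in S)) => //= xS.
      by rewrite (disjointFl dS xS).
    by rewrite negbK.
  case=> /eqP c' /eqP E; have dS : [disjoint S' & S].
    rewrite -E -setI_eq0; apply/eqP/setP => x; rewrite !inE; by case: (x \in S); rewrite ?andbF.
  split=> //; have := cardsC (S :|: S').
  by rewrite cardsU (eqP (_ : S :&: S' == set0)) ?setI_eq0 1?disjoint_sym // cards0; lia.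
move=> S' /andP[dS _]; apply/setP => x; rewrite !inE.
case: (boolP (x \in S)) => //= xS; first by rewrite (disjointFl dS xS).
by rewrite negbK.
Qed.

(** Summed over ordered partitions, the squares of the three values get weights [1/10], [1/10] and
    [4/5]. These add up to 1, so the squares never outweigh the pair products, whose sum is -1
    unless all three values vanish. *)
Lemma partition_form_le0 u :
  (forall S, u S ^+ 2 <= 1) ->
  (forall S S', [disjoint S' & S] ->
     [/\ u S = 0, u S' = 0 & u (~: (S :|: S')) = 0] \/
     u S * u S' + u S * u (~: (S :|: S')) + u S' * u (~: (S :|: S')) = -1) ->
  \sum_(S : {set V} | #|S| == s) \sum_(S' : {set V} | [disjoint S' & S] && (#|S'| == s)) u S * u S' +
  2 * (\sum_(S : {set V} | #|S| == s) \sum_(S' : {set V} | [disjoint S' & S] && (#|S'| == t)) u S * u S') +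
  N / 5 * dot s u u + 4 / 5 * M * dot t u u <= 0.
Proof.
move=> u1 cons.
pose SS (G : {set V} -> {set V} -> R) := \sum_(S : {set V} | #|S| == s)
  \sum_(S' : {set V} | [disjoint S' & S] && (#|S'| == s)) G S S'.
have SSsym G : SS G = SS (fun S S' => G S' S).
  rewrite /SS (exchange_big_dep (fun S' : {set V} => #|S'| == s)) /=; last by move=> S S' _ /andP[].
  apply: eq_bigr => S' /eqP cS'; apply: eq_bigl => S.
  by rewrite cS' eqxx andbT disjoint_sym andbC.
pose third S S' := ~: (S :|: S').
have S13 : \sum_(S : {set V} | #|S| == s)
    \sum_(S' : {set V} | [disjoint S' & S] && (#|S'| == t)) u S * u S' =
    SS (fun S S' => u S * u (third S S')).
  by apply: eq_bigr => S /eqP cS; rewrite -(sum_third (fun S' => u S * u S') cS).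
have S23 : SS (fun S S' => u S * u (third S S')) = SS (fun S S' => u S' * u (third S S')).
  by rewrite SSsym; apply: eq_bigr => S _; apply: eq_bigr => S' _; rewrite /third setUC.
have S11 : N * dot s u u = SS (fun S _ => u S ^+ 2).
  by rewrite /SS (sum_disjoint_const s s (fun S => u S ^+ 2)) nE -addnA addKn.
have S22 : N * dot s u u = SS (fun _ S' => u S' ^+ 2) by rewrite S11 SSsym.
have S33 : M * dot t u u = SS (fun S S' => u (third S S') ^+ 2).
  transitivity (\sum_(S : {set V} | #|S| == s)
    \sum_(S' : {set V} | [disjoint S' & S] && (#|S'| == t)) 1 * u S' ^+ 2).
    rewrite (disjoint_sum_sym s t (fun=> 1) (fun S => u S ^+ 2)).
    rewrite (eq_bigr (fun S => \sum_(S' : {set V} | [disjoint S' & S] && (#|S'| == s)) u S ^+ 2)).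
      by rewrite sum_disjoint_const nE addnK.
    by move=> S _; apply: eq_bigr => S' _; rewrite mul1r.
  apply: eq_bigr => S /eqP cS; rewrite -(sum_third (fun S' => 1 * u S' ^+ 2) cS).
  by apply: eq_bigr => S' _; rewrite mul1r.
rewrite S13 -/(SS (fun S S' => u S * u S')).
set X := SS _; set Y := SS _.
have -> : X + 2 * Y + N / 5 * dot s u u + 4 / 5 * M * dot t u u =
   X + Y + Y + (N * dot s u u) / 10 + (N * dot s u u) / 10 + 4 / 5 * (M * dot t u u) by field.
rewrite {2}S22 S11 S33 {2}/Y S23 /X /Y /SS ![_ / 10]mulrC !mulr_sumr -!big_split /=.
apply: sumr_le0 => S cS; rewrite !mulr_sumr -!big_split /=.
apply: sumr_le0 => S' /andP[dS _]; 
have := u1 S; have := u1 S'; have := u1 (third S S') => a b c.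
have := cons S S' dS; rewrite -/(third S S') => -[[-> -> ->]|E]; last lra.
by rewrite !mulr0 expr0n /= !mulr0 !addr0.
Qed.

(** Counts the disjoint pairs of sizes [s] and [t] from either member; it gives all terms of the
    final inequality a common factor. *)
Lemma card_partitions : N * 'C(n, s)%:R = M * 'C(n, t)%:R.
Proof.
have one r : 'C(n, r)%:R = \sum_(S : {set V} | #|S| == r) 1 :> R.
  by rewrite -card_draws -sumr_const; apply: eq_bigl => S; rewrite inE.
have := @disjoint_sum_sym V R s t (fun=> 1) (fun=> 1).
have := sum_disjoint_const s t (fun=> 1); have := sum_disjoint_const t s (fun=> 1).
rewrite !mulr1 -!one => -> ->; rewrite nE addnK -addnA addKn => <-.
by rewrite -bin_sub ?leq_addr // addKn.
Qed.

Hypotheses (s0 : (0 < s)%N) (t0 : (0 < t)%N).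
Hypotheses (hs : (49 * (s + t) <= 100 * s)%N) (ht : (49 * (s + t) <= 100 * t)%N).

(** Of the weight [4/5] on slice [t] in the upper bound, the lower bound consumes [2/5]; the
    remaining [2/5] yields the term in [p + q] required by [minority_arith]. *)
Lemma slice_minority u :
  (forall S, [|| u S == 1, u S == 0 | u S == -1]) ->
  (forall A B, A \subset B -> u B <= u A) ->
  (forall S S', [disjoint S' & S] ->
     [/\ u S = 0, u S' = 0 & u (~: (S :|: S')) = 0] \/
     u S * u S' + u S * u (~: (S :|: S')) + u S' * u (~: (S :|: S')) = -1) ->
  (forall v w, \sum_(S : {set V} | (#|S| == s) && (v \in S)) u S =
               \sum_(S : {set V} | (#|S| == s) && (w \in S)) u S) ->
  ((t <= s)%N -> mean t (fun S => (u S == -1)%:R : R) <= 1 / 50) /\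
  ((s <= t)%N -> mean t (fun S => (u S == 1)%:R : R) <= 1 / 50).
Proof.
move=> uval anti cons tr.
have sn : (s <= n)%N by lia.
have tn : (t <= n)%N by lia.
have u1 S : u S ^+ 2 <= 1.
  by case/or3P: (uval S) => /eqP ->; rewrite ?sqrrN ?expr1n ?expr0n //= ler01.
have := partition_form_bound s0 t0 nE hs ht tr; have := partition_form_le0 u1 cons.
set X := \sum_(S | _) _; set Y := \sum_(S | _) _.
set p := mean t (fun S => (u S == 1)%:R); set q := mean t (fun S => (u S == -1)%:R).
have N0 : 0 < N * 'C(n, s)%:R by rewrite -natrM ltr0n muln_gt0 !bin_gt0; lia.
have Ct : 0 < 'C(n, t)%:R :> R by rewrite ltr0n bin_gt0; lia.
have case3 S : [\/ u S = 1, u S = 0 | u S = -1].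
  by case/or3P: (uval S) => /eqP; [constructor 1|constructor 2|constructor 3].
have n11 : (-1 == 1 :> R) = false by apply/negP => /eqP; lra.
have n1 : (1 == -1 :> R) = false by rewrite eq_sym.
have n01 : (0 == -1 :> R) = false by apply/negP => /eqP; lra.
have n10 : (0 == 1 :> R) = false by apply/negP => /eqP; lra.
have xE : mean t u = p - q.
  rewrite /p /q /mean -mulrBl -sumrB; congr (_ / _); apply: eq_bigr => S _.
  by case: (case3 S) => ->; rewrite ?eqxx ?n11 ?n1 ?n01 ?n10 ?subr0 ?sub0r.
have dE : dot t u u = 'C(n, t)%:R * (p + q).
  rewrite /p /q /mean -mulrDl mulrC divfK ?lt0r_neq0 // -big_split; apply: eq_bigr => S _.
  by case: (case3 S) => ->; rewrite /= ?eqxx ?n11 ?n1 ?n01 ?n10 ?mulrNN ?mulr1 ?mulr0 ?addr0 ?add0r.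
have p0 : 0 <= p by rewrite divr_ge0 ?ler0n // sumr_ge0 // => S _; rewrite ler0n.
have q0 : 0 <= q by rewrite divr_ge0 ?ler0n // sumr_ge0 // => S _; rewrite ler0n.
have pq1 : p + q <= 1.
  rewrite /p /q /mean -mulrDl ler_pdivrMr // mul1r -big_split /=.
  rewrite -[X in _ <= X%:R]card_slice -sumr_const.
  rewrite [leRHS](eq_bigl (fun S : {set V} => #|S| == t)); last by move=> S; rewrite inE.
  apply: ler_sum => S _.
  by case: (case3 S) => ->; rewrite ?eqxx ?n11 ?n1 ?n01 ?n10 ?addr0 ?add0r.
move=> B A.
have {A B} : N * 'C(n, s)%:R * (6 / 5 * mean s u ^+ 2 + 2 * mean s u * mean t u +
    2 / 5 * mean t u ^+ 2 + 2 / 5 * (p + q)) <= 0.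
  have -> : N * 'C(n, s)%:R * (6 / 5 * mean s u ^+ 2 + 2 * mean s u * mean t u +
      2 / 5 * mean t u ^+ 2 + 2 / 5 * (p + q)) =
    N * 'C(n, s)%:R * (6 / 5 * mean s u ^+ 2 + 2 * mean s u * mean t u) +
    2 / 5 * M * 'C(n, t)%:R * mean t u ^+ 2 + 2 / 5 * M * ('C(n, t)%:R * (p + q)).
    rewrite -!(mulrA (2 / 5)) (mulrA M) -card_partitions; ring.
  rewrite dE in A B.
  have -> : 2 / 5 * M * ('C(n, t)%:R * (p + q)) = 4 / 5 * M * ('C(n, t)%:R * (p + q)) -
    2 / 5 * M * ('C(n, t)%:R * (p + q)) by field.
  lra.
rewrite pmulr_rle0 // xE => E; split=> st.
  by apply: (minority_arith p0 q0 pq1 _ E); rewrite -xE; apply: mean_antitone => //; rewrite st.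
(* Changing the sign of [u] exchanges [p] and [q] and reverses the monotonicity of the means. *)
apply: (@minority_arith R q p (- mean s u)) => //; first by rewrite addrC.
  by rewrite -opprB -xE lerN2; apply: mean_antitone => //; rewrite st.
by apply: le_trans E; rewrite le_eqVlt; apply/orP; left; apply/eqP; ring.
Qed.
End Partition.

(** The bound is obtained on a slice [t] next to [n / 3], between [n / 3] and [r], and carried to
    [r] because the indicators of [u = -1] and [u = 1] are monotone in opposite directions. *)
Lemma minority_bound u k r :
  (50 <= k)%N -> n = (3 * k + 1)%N \/ n = (3 * k + 2)%N ->
  (forall S, [|| u S == 1, u S == 0 | u S == -1]) ->
  (forall A B, A \subset B -> u B <= u A) ->
  (forall S S', [disjoint S' & S] ->
     [/\ u S = 0, u S' = 0 & u (~: (S :|: S')) = 0] \/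
     u S * u S' + u S * u (~: (S :|: S')) + u S' * u (~: (S :|: S')) = -1) ->
  (forall s v w, \sum_(S : {set V} | (#|S| == s) && (v \in S)) u S =
                 \sum_(S : {set V} | (#|S| == s) && (w \in S)) u S) ->
  ((3 * r + 1 < n)%N -> mean r (fun S => (u S == -1)%:R : R) <= 1 / 50) /\
  ((n + 1 < 3 * r)%N -> (r <= n)%N -> mean r (fun S => (u S == 1)%:R : R) <= 1 / 50).
Proof.
move=> k50 nk uval anti cons tr.
have u_le1 S : u S <= 1 by case/or3P: (uval S) => /eqP ->; lra.
have u_geN1 S : -1 <= u S by case/or3P: (uval S) => /eqP ->; lra.
have negS : forall A B, A \subset B -> - (u B == -1)%:R <= - (u A == -1)%:R :> R.
  move=> A B AB; rewrite lerN2 ler_nat.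
  case: (u A =P -1) => // uA; case: eqP => // -[]; apply/eqP.
  by rewrite eq_le u_geN1 -uA anti.
have posS : forall A B, A \subset B -> (u B == 1)%:R <= (u A == 1)%:R :> R.
  move=> A B AB; rewrite ler_nat.
  case: (u B =P 1) => // uB; case: eqP => // -[]; apply/eqP.
  by rewrite eq_le u_le1 -uB anti.
have meanN s (w : {set V} -> R) : mean s (fun S => - w S) = - mean s w.
  by rewrite /mean sumrN mulNr.
split=> [rn|nr rn].
  have [s [t [nE s0 t0 /andP[hs ht] /andP[ts rt]]]] : exists s t,
      [/\ n = (s + s + t)%N, (0 < s)%N, (0 < t)%N,
          (49 * (s + t) <= 100 * s)%N && (49 * (s + t) <= 100 * t)%N & (t <= s)%N && (r <= t)%N].
    (* The largest [t] below [n / 3] with [n - t] even and [t <= s]. The ratio condition for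
       [t = k - 1] reads [98 * k <= 100 * (k - 1)], whence the threshold 50. *)
    by case: nk => nk; [exists k.+1, k.-1|exists k.+1, k]; split; lia.
  have [/(_ ts) H _] := slice_minority nE s0 t0 hs ht uval anti cons (tr s).
  apply: le_trans H; rewrite -lerN2 -!meanN; apply: mean_antitone => //.
  by rewrite rt; lia.
have [s [t [nE s0 t0 /andP[hs ht] /andP[st tr']]]] : exists s t,
    [/\ n = (s + s + t)%N, (0 < s)%N, (0 < t)%N,
        (49 * (s + t) <= 100 * s)%N && (49 * (s + t) <= 100 * t)%N & (s <= t)%N && (t <= r)%N].
  by case: nk => nk; [exists k, k.+1|exists k, k.+2]; split; lia.
have [_ /(_ st) H] := slice_minority nE s0 t0 hs ht uval anti cons (tr s).
by apply: le_trans H; apply: mean_antitone => //; rewrite tr' rn.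
Qed.
End Minority.

(** * Elections over the Condorcet cycle *)

Definition flip (o : outcome) : outcome :=
  match o with Win => Loss | Tie => Tie | Loss => Win end.

Definition outcome_num (R : pzRingType) (o : outcome) : R :=
  match o with Win => 1 | Tie => 0 | Loss => -1 end.

Lemma outcome_of_flip w i j : outcome_of w i j = flip (outcome_of w j i).
Proof.
rewrite /outcome_of /prefers.
by case: ((i, j) \in val w); case: ((j, i) \in val w).
Qed.

Lemma outcome_of_relabel (rho : {perm cand}) w i j :
  outcome_of (relabel_order rho w) (rho i) (rho j) = outcome_of w i j.
Proof. by rewrite /outcome_of /prefers !inE /= !permK. Qed.

(** Around a cycle, a weak order gives three ties or else at least one win and one loss; a triple of
    signs containing both 1 and -1 has pair products adding up to -1. *)
Lemma outcome_of_cycle (R : realFieldType) w (x y z : cand) :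
  let a := outcome_num R (outcome_of w x y) in
  let b := outcome_num R (outcome_of w y z) in
  let c := outcome_num R (outcome_of w z x) in
  [/\ a = 0, b = 0 & c = 0] \/ a * b + a * c + b * c = -1.
Proof.
case: w => S wS; have /andP[/forallP tot /forallP trans] := wS.
have to p q : ((p, q) \in S) || ((q, p) \in S) by move/forallP: (tot p).
have tr p q r : ((p, q) \in S) ==> ((q, r) \in S) ==> ((p, r) \in S).
  by have /forallP/(_ q)/forallP/(_ r) := trans p.
move: (to x y) (to y z) (to z x) (tr x y z) (tr y z x) (tr z x y)
  (tr x z y) (tr z y x) (tr y x z).
rewrite /outcome_of /prefers /=.
case: ((x, y) \in S); case: ((y, x) \in S); case: ((y, z) \in S);
case: ((z, y) \in S); case: ((z, x) \in S); case: ((x, z) \in S) => //= _ _ _ _ _ _ _ _ _.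
all: by [left | right; rewrite ?(mul0r, mulr0, mul1r, mulr1, mulrNN, add0r, addr0, subrr, addrN, addNr); lra].
Qed.

Lemma ballot_inj (m : cand) : injective (fun c : cand => m - c).
Proof. by move=> x y /addrI /oppr_inj. Qed.

(** The Condorcet cycle consists of the maps sending [c] to [m - c] modulo 3. Here [m] is at once
    the rank of candidate [0] and the candidate ranked last. *)
Definition cyclic_ballot (m : cand) : ballot := perm (@ballot_inj m).

Lemma cyclic_ballot_in m : cyclic_ballot m \in condorcet_cycle.
Proof.
rewrite inE /ballot_is !permE.
by case: m => -[|[|[|]]].
Qed.

Lemma condorcet_ballotE (r : ballot) c : r \in condorcet_cycle -> r c = r 0 - c.
Proof.
rewrite inE => H; apply/val_inj.
have -> : (0 : cand) = cand1 by apply/val_inj.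
have : [\/ c = cand1, c = cand2 | c = cand3].
  by case: c {H} => -[|[|[|//]]] i; [constructor 1|constructor 2|constructor 3]; apply/val_inj.
by case=> ->; case/or3P: H => /and3P[/eqP E1 /eqP E2 /eqP E3]; rewrite /= ?E1 ?E2 ?E3.
Qed.

Lemma cand_neq (i j : cand) : i != j -> j = i + 1 \/ i = j + 1.
Proof.
case: i => -[|[|[|//]]] ?; case: j => -[|[|[|//]]] ? //= _;
  by [left; apply/val_inj | right; apply/val_inj].
Qed.

Section Bridge.
Variables (V : finType) (E : {set election V}).
Hypothesis hCC : CC E.

Definition blocs (S : {set V}) : rel_election V :=
  [ffun v => if v \in S then - 2 else 1].

(** On the Condorcet cycle the rank of candidate [0] names the candidate ranked last, so these are
    the voters who put [i] last and [i + 1] first. *)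
Definition bloc (e : election V) (i : cand) : {set V} := [set v | e v 0 == i].

Lemma rel_of_bloc e i : e \in E -> rel_of i (i + 1) e = blocs (bloc e i).
Proof.
rewrite hCC inE => /forallP He; apply/ffunP => v; rewrite !ffunE inE.
rewrite (condorcet_ballotE i (He v)) (condorcet_ballotE (i + 1) (He v)).
case: (e v 0) => -[|[|[|//]]] p; case: i => -[|[|[|//]]] q //=.
Qed.

Lemma rel_of_opp i j (e : election V) v : rel_of j i e v = - rel_of i j e v.
Proof. by rewrite !ffunE opprB. Qed.

Definition cyclic_election (m : V -> cand) : election V := [ffun v => cyclic_ballot (m v)].

Lemma cyclic_election_in m : cyclic_election m \in E.
Proof. by rewrite hCC inE; apply/forallP => v; rewrite ffunE cyclic_ballot_in. Qed.

Definition domain_election m : {e : election V | e \in E} :=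
  exist (fun e => is_true (e \in E)) _ (cyclic_election_in m).

Lemma bloc_cyclic m i : bloc (cyclic_election m) i = [set v | m v == i].
Proof. by apply/setP => v; rewrite !inE ffunE permE subr0. Qed.

Lemma d1_blocs S : d1 (blocs S) = #|V|%:Z - 3 * #|S|%:Z.
Proof.
rewrite /d1 (eq_bigr (fun v => 1 - 3 * (v \in S : nat)%:Z)); last first.
  by move=> v _; rewrite ffunE; case: (v \in S).
rewrite sumrB sumr_const -mulr_sumr -(big_morph Posz PoszD (erefl _)).
have -> : (\sum_v (v \in S) = #|S|)%N.
  by rewrite -sum1_card [RHS]big_mkcond; apply: eq_bigr => v _; case: (v \in S).
by rewrite !natz.
Qed.

Lemma blocs_inj : injective blocs.
Proof.
move=> S S' /ffunP H; apply/setP => v; have := H v; rewrite !ffunE.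
by case: (v \in S); case: (v \in S').
Qed.

Lemma borda_outcome i j (e : {e : election V | e \in E}) :
  outcome_of (borda e) i j = phi (d1 (rel_of i j (val e))).
Proof.
rewrite /outcome_of /prefers !inE /=.
have -> : d1 (rel_of i j (val e)) =
    (\sum_v (val e v i : nat))%N%:Z - (\sum_v (val e v j : nat))%N%:Z.
  rewrite /d1 !(big_morph Posz PoszD (erefl _)) -sumrB.
  by apply: eq_bigr => v _; rewrite ffunE.
rewrite /phi subr_gt0 subr_eq0 ltz_nat eqz_nat.
by case: ltngtP.
Qed.

Variables (F : swf E) (f : cand -> cand -> rel_election V -> outcome).
Hypotheses (hM : MIIA F f) (hN : neutrality F).
Implicit Types (S : {set V}).

(** Defined on one pair of candidates; by neutrality the same function decides all three pairs [i],
    [i + 1]. *)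
Definition verdict S : outcome := f 0 1 (blocs S).

Lemma cand_succ_neq (j : cand) : j + 1 != j.
Proof. by rewrite -subr_eq0 addrC addKr. Qed.

(** Rotating the candidates preserves the Condorcet cycle, so neutrality applies to an election with
    bloc [S] at [j] and to its rotation, which has bloc [S] at [j + 1]. *)
Lemma relative_swf_shift (j : cand) S :
  f (j + 1) (j + 1 + 1) (blocs S) = f j (j + 1) (blocs S).
Proof.
pose shift : {perm cand} := perm (@addIr _ (1 : cand)).
pose m v := if v \in S then j else j + 1.
pose e0 := domain_election m.
pose e1 := domain_election (fun v => m v + 1).
have b0 : bloc (val e0) j = S.
  apply/setP => v; rewrite bloc_cyclic inE /m.
  by case: (v \in S); rewrite ?eqxx // (negPf (cand_succ_neq j)).
have b1 : bloc (val e1) (j + 1) = S.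
  by rewrite -b0 !bloc_cyclic; apply/setP => v; rewrite !inE (inj_eq (addIr _)).
have e01 : val e1 = relabel_election shift (val e0).
  have sV c : (shift^-1)%g c = c - 1.
    by apply: (@perm_inj _ shift); rewrite permKV permE subrK.
  apply/ffunP => v; rewrite !ffunE; apply/permP => c.
  by rewrite permM sV !permE opprB addrA addrAC.
have ne (l : cand) : l != l + 1 by rewrite eq_sym cand_succ_neq.
rewrite -{1}b1 -b0 -!rel_of_bloc ?(valP e0) ?(valP e1) // !hM //.
have sE l : shift l = l + 1 by rewrite permE.
by rewrite (hN e01) -(outcome_of_relabel shift (F e0)) !sE.
Qed.

Lemma verdictE (e : {e : election V | e \in E}) i :
  outcome_of (F e) i (i + 1) = verdict (bloc (val e) i).
Proof.
have ii : i != i + 1 by rewrite eq_sym cand_succ_neq.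
rewrite -(hM ii) rel_of_bloc ?(valP e) // /verdict.
move: (bloc _ _) => S.
have s0 := relative_swf_shift 0 S; have s1 := relative_swf_shift (0 + 1) S.
have : [\/ i = 0, i = 0 + 1 | i = 0 + 1 + 1].
  by case: (i : cand) => -[|[|[|//]]] p; [constructor 1|constructor 2|constructor 3]; apply/val_inj.
have e1 : 0 + 1 = 1 :> cand by rewrite add0r.
by case=> ->; rewrite ?s1 ?s0 e1.
Qed.

Section Numeric.
Variable R : realFieldType.
Let u S : R := outcome_num R (verdict S).

Lemma verdict_num_consistent S S' : [disjoint S' & S] ->
  [/\ u S = 0, u S' = 0 & u (~: (S :|: S')) = 0] \/
  u S * u S' + u S * u (~: (S :|: S')) + u S' * u (~: (S :|: S')) = -1.
Proof.
(* An election with blocs [S], [S'] and the rest. The sums [0 + 1] stay unreduced to match the form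
   [i + 1] in [verdictE]. *)
move=> dS; pose m v : cand := if v \in S then 0 else if v \in S' then 0 + 1 else 0 + 1 + 1.
pose e := domain_election m.
have := outcome_of_cycle R (F e) 0 (0 + 1) (0 + 1 + 1); cbv zeta.
have -> : outcome_of (F e) (0 + 1 + 1) 0 = outcome_of (F e) (0 + 1 + 1) (0 + 1 + 1 + 1).
  by congr outcome_of; apply/val_inj.
rewrite !verdictE !bloc_cyclic.
rewrite (_ : [set v | m v == 0] = S); last first.
  by apply/setP => v; rewrite inE /m; case: (v \in S) => //; case: (v \in S').
rewrite (_ : [set v | m v == 0 + 1] = S'); last first.
  apply/setP => v; rewrite inE /m; case: (boolP (v \in S)) => [vS|_]; last by case: (v \in S').
  by rewrite (disjointFl dS vS).
rewrite (_ : [set v | m v == 0 + 1 + 1] = ~: (S :|: S')) //.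
by apply/setP => v; rewrite !inE /m; case: (v \in S) => //; case: (v \in S').
Qed.

(** Enlarging the bloc replaces entries 1 by -2, which lowers the relative election pointwise. *)
Lemma verdict_num_antitone : positive_responsiveness E f ->
  forall A B : {set V}, A \subset B -> u B <= u A.
Proof.
move=> hP A B AB.
have in_rel S : blocs S \in rel_elections_of E 0 1.
  pose m v : cand := if v \in S then 0 else 1.
  have <- : rel_of 0 1 (cyclic_election m) = blocs S.
    have := @rel_of_bloc _ 0 (cyclic_election_in m); rewrite add0r => ->.
    rewrite bloc_cyclic; congr blocs; apply/setP => v; rewrite inE /m.
    by case: (v \in S).
  by apply/in_imfset/cyclic_election_in.
have le v : blocs B v <= blocs A v.
  by rewrite !ffunE; case: (boolP (v \in A)) => [/(subsetP AB) -> //|_]; case: ifP.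
have := hP 0 1 isT _ _ (in_rel A) (in_rel B) le.
rewrite /outcome_le /u /verdict.
by case: (f 0 1 (blocs A)); case: (f 0 1 (blocs B)) => /=; rewrite ?inordK // => _; lra.
Qed.

(** Anonymity under [g] makes [u] invariant under preimages by [act g]; with [act g v = w], these
    carry the sets containing [w] to those containing [v]. *)
Lemma verdict_num_transitive : transitive_anonymity F ->
  forall s v w, \sum_(S : {set V} | (#|S| == s) && (v \in S)) u S =
                \sum_(S : {set V} | (#|S| == s) && (w \in S)) u S.
Proof.
case=> G [act [[act1 actM actT] hF]] s v w.
have [g gv] := actT v w.
have actK : cancel (act g) (act (g^-1)%g) by move=> x; rewrite -actM mulVg act1.
have actVK : cancel (act (g^-1)%g) (act g) by move=> x; rewrite -actM mulgV act1.
have uE S : u (act g @^-1: S) = u S.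
  pose m v : cand := if v \in S then 0 else 1.
  pose e := domain_election m.
  pose e' := domain_election (m \o act g).
  have ee' : F e' = F e by apply: (hF g); apply/ffunP => x; rewrite !ffunE.
  have bS : bloc (val e) 0 = S.
    by rewrite bloc_cyclic; apply/setP => x; rewrite inE /m; case: (x \in S).
  have bS' : bloc (val e') 0 = act g @^-1: S.
    by rewrite bloc_cyclic; apply/setP => x; rewrite !inE /= /m; case: (act g x \in S).
  by rewrite /u -bS' -bS -!verdictE ee'.
rewrite [LHS](reindex_onto (fun S => act g @^-1: S) (fun S => act (g^-1)%g @^-1: S)) /=.
  apply: eq_big => [S|S _]; last exact: uE.
  rewrite inE gv (card_preimset _ (can_inj actK)) andbC -[RHS]andTb; congr (_ && _).
  by apply/eqP/setP => x; rewrite !inE actVK.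
by move=> S _; apply/setP => x; rewrite !inE actK.
Qed.
End Numeric.

(** The sign [b] records the orientation: [false] for a pair [i], [i + 1], [true] for the reversed
    pair. *)
Definition signed_blocs (b : bool) S : rel_election V := [ffun v => (-1) ^+ b * blocs S v].

Lemma signed_blocs_inj b : injective (signed_blocs b).
Proof.
move=> S S' /ffunP H; apply: blocs_inj; apply/ffunP => v; have := H v.
by rewrite !(ffunE (fun v => (-1) ^+ b * _)) => /mulfI; apply; rewrite signr_eq0.
Qed.

Lemma d1_signed_blocs b S : d1 (signed_blocs b S) = (-1) ^+ b * (#|V|%:Z - 3 * #|S|%:Z).
Proof. by rewrite -d1_blocs /d1 mulr_sumr; apply: eq_bigr => v _; rewrite ffunE. Qed.

Lemma rel_of_signed_blocs (i j : cand) e : i != j -> e \in E ->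
  exists b, rel_of i j e = signed_blocs b (bloc e (if b then j else i)) /\
            (if b then i = j + 1 else j = i + 1).
Proof.
move=> ij eE; case: (cand_neq ij) => ->; [exists false|exists true]; split => //; apply/ffunP => v.
  by rewrite rel_of_bloc // [RHS]ffunE mul1r.
by rewrite rel_of_opp rel_of_bloc // [RHS]ffunE mulN1r.
Qed.

(** The two orientations take values in the disjoint sets {-2, 1} and {2, -1}, so a single voter
    reveals the sign. *)
Lemma signed_blocs_sign b b' S S' : (0 < #|V|)%N -> signed_blocs b S = signed_blocs b' S' -> b = b'.
Proof.
case/card_gt0P => v _ /ffunP/(_ v); rewrite !ffunE.
by case: b; case: b'; case: (v \in S); case: (v \in S').
Qed.

Lemma signed_blocs_rel b S : signed_blocs b S \in rel_elections E.
Proof.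
pose m v : cand := if v \in S then 0 else 1.
have bS : bloc (cyclic_election m) 0 = S.
  by rewrite bloc_cyclic; apply/setP => x; rewrite inE /m; case: (x \in S).
have R01 : rel_of 0 (0 + 1) (cyclic_election m) = blocs S.
  by rewrite rel_of_bloc ?bS // cyclic_election_in.
apply/bigfcupP; exists (if b then (0 + 1, 0) else (0, 0 + 1)).
  by rewrite mem_enum; case: b.
apply/imfsetP; exists (cyclic_election m); first exact: cyclic_election_in.
apply/ffunP => v; rewrite ffunE -R01; case: b => /=; last by rewrite mul1r.
by rewrite [RHS]rel_of_opp mulN1r.
Qed.

Lemma rel_electionsP a : a \in rel_elections E -> exists b S, a = signed_blocs b S.
Proof.
case/bigfcupP => -[i j] /andP[_ ij] /imfsetP[e /= eE ->].
by have [b [-> _]] := rel_of_signed_blocs ij eE; exists b, (bloc e (if b then j else i)).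
Qed.

(** As 3 does not divide [#|V|], the two orientations give values of [d1] in different residue
    classes modulo 3; hence [d] determines both [b] and the size of the bloc. *)
Lemma rel_elections_withE (b : bool) (r : nat) : ~~ (3 %| #|V|)%N ->
  rel_elections_with E ((-1) ^+ b * (#|V|%:Z - 3 * r%:Z)) =
  [fset signed_blocs b S | S in [set S : {set V} | #|S| == r]]%fset.
Proof.
move=> n3; apply/fsetP => a; rewrite !inE /=; apply/andP/imfsetP => /=.
  case=> /rel_electionsP[b' [S ->]] /eqP; rewrite d1_signed_blocs => dE.
  have [-> Sr] : b' = b /\ #|S| = r.
    move: #|S| dE => c; move: n3; move: #|V| => n; clear.
    by case: b; case: b'; rewrite ?expr0 ?expr1 ?mul1r ?mulN1r => *; split; lia.
  by exists S => //; rewrite inE Sr.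
case=> S; rewrite inE => /eqP Sr ->; split; first exact: signed_blocs_rel.
by rewrite d1_signed_blocs Sr.
Qed.

(** Ties count as success, so only a verdict opposite to the sign of the margin can fail; reversing
    the pair flips verdict and margin together. *)
Lemma signed_blocs_agree (b : bool) S (d : int) : (0 < #|V|)%N -> 1 < `|d| ->
  d = (-1) ^+ b * (#|V|%:Z - 3 * #|S|%:Z) ->
  verdict S != (if 0 < #|V|%:Z - 3 * #|S|%:Z :> int then Loss else Win) ->
  agrees_or_ties F d (signed_blocs b S).
Proof.
move=> V0 d1 dE good.
apply/forallP => i; apply/forallP => j; apply/implyP => ij.
apply/forallP => e; apply/implyP => /eqP re.
rewrite borda_outcome re d1_signed_blocs -dE.
have [b' [eb bij]] := rel_of_signed_blocs ij (valP e).
have bb : b' = b := signed_blocs_sign V0 (etrans (esym eb) re).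
rewrite bb re in eb bij; have {eb} SE := signed_blocs_inj eb.
have oE : outcome_of (F e) i j = if b then flip (verdict S) else verdict S.
  case: (b) SE bij => -> ->; last exact: verdictE.
  by rewrite outcome_of_flip verdictE.
rewrite oE eqxx andbT; move: good d1 dE; rewrite /phi.
move: (_ - _ : int) => x; case: (b); rewrite ?mul1r ?mulN1r => good d1 dE; subst d.
  rewrite oppr_gt0 oppr_eq0 normrN in d1 *; case: ltrgt0P good d1 => //= _.
    by case: (verdict S); rewrite ?eqxx ?orbT.
  by case: (verdict S); rewrite ?eqxx ?orbT.
by case: ltrgt0P good d1 => //= _; case: (verdict S); rewrite ?eqxx ?orbT.
Qed.
End Bridge.

(** * The proportion of good relative elections *)

Lemma card_imfset_set (T : finType) (K : choiceType) (g : T -> K) (A : {set T}) :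
  injective g -> #|` [fset g x | x in A]%fset| = #|A|.
Proof.
by move=> gi; rewrite card_imfset //= cardE. Qed.

Lemma outcome_num_inj (R : realFieldType) : injective (outcome_num R).
Proof.
by case; case=> //= ?; exfalso; lra.
Qed.

Theorem mainTheorem3 (R : realType) :
  exists (K : R) (k0 : nat),
    forall (k : nat) (V : finType) (E : {set election V}) (F : swf E)
           (f : cand -> cand -> rel_election V -> outcome),
      (k0 <= k)%N ->
      #|V| = (3 * k + 1)%N \/ #|V| = (3 * k + 2)%N ->
      CC E -> MIIA F f -> neutrality F -> positive_responsiveness E f ->
      transitive_anonymity F ->
      forall d : int,
        (exists2 a, a \in rel_elections E & d1 a = d) ->
        1 < `|d| ->
        exists2 eps : R, `|eps| <= K / k%:R &
          5 / (3 * Num.sqrt 3) + eps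
            <= uniform_prob R (rel_elections_with E d) (agrees_or_ties F d).
Proof.
(* A zero constant [K] suffices, since the bound [49/50] exceeds the main term; 50 is the threshold
   of [minority_bound]. *)
exists 0, 50%N => k V E F f k50 nk hCC hM hN hP hT d [a aE ad] d_gt1.
exists 0; first by rewrite normr0 mul0r.
(* Equivalent to [250 <= 147 * Num.sqrt 3]. *)
have sqrt3 : 5 / (3 * Num.sqrt 3) <= 49 / 50 :> R.
  have s3 : 0 < Num.sqrt 3 :> R by rewrite sqrtr_gt0 ltr0n.
  rewrite ler_pdivrMr ?mulr_gt0 ?ltr0n //.
  have : Num.sqrt 3 ^+ 2 = 3 :> R by rewrite sqr_sqrtr ?ler0n.
  nra.
rewrite addr0; apply: (le_trans sqrt3).
have [b [S0 a0]] := rel_electionsP hCC aE.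
pose r := #|S0|; have rn : (r <= #|V|)%N := max_card _.
have V0 : (0 < #|V|)%N by lia.
have dE : d = (-1) ^+ b * (#|V|%:Z - 3 * r%:Z) by rewrite -ad a0 d1_signed_blocs.
have n3 : ~~ (3 %| #|V|)%N by lia.
pose bad := if 0 < #|V|%:Z - 3 * r%:Z :> int then Loss else Win.
pose slice := [set S : {set V} | #|S| == r].
pose good := [set S in slice | verdict f S != bad].
have Ccard : #|slice| = 'C(#|V|, r) by rewrite card_draws.
have C0 : 0 < 'C(#|V|, r)%:R :> R by rewrite ltr0n bin_gt0.
have goodE : 49 / 50 * 'C(#|V|, r)%:R <= #|good|%:R :> R.
  have num3 S : let u := outcome_num R (verdict f S) in [|| u == 1, u == 0 | u == -1].
    by case: (verdict f S); rewrite /= eqxx ?orbT.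
  have [Hneg Hpos] := minority_bound r k50 nk num3
    (verdict_num_antitone hCC R hP) (verdict_num_consistent hCC hM hN R)
    (verdict_num_transitive hCC hM hN R hT).
  have meanE o : mean r (fun S => (outcome_num R (verdict f S) == outcome_num R o)%:R : R) =
      mean r (fun S => (verdict f S == o)%:R).
    by congr (_ / _); apply: eq_bigr => S _; rewrite (inj_eq (@outcome_num_inj R)).
  have bad_le : mean r (fun S => (verdict f S == bad)%:R : R) <= 1 / 50.
    (* [|d| > 1] says that [3 * r] differs from [n] by at least 2, which is what either half of
       [minority_bound] asks. *)
    have := d_gt1; rewrite dE normrMsign => dn.
    rewrite /bad; case: ifP => nr; rewrite -meanE; first by apply: Hneg; lia.
    by apply: Hpos => //; lia.
  have -> : #|good|%:R = 'C(#|V|, r)%:R - 'C(#|V|, r)%:R * mean r (fun S => (verdict f S == bad)%:R) :> R.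
    rewrite /mean mulrC divfK ?lt0r_neq0 // -Ccard -!sumr_const.
    rewrite (eq_bigl (fun S : {set V} => (#|S| == r) && (verdict f S != bad))); last first.
      by move=> S; rewrite !inE.
    rewrite [X in _ = X - _](eq_bigl (fun S : {set V} => #|S| == r)); last first.
      by move=> S; rewrite !inE.
    rewrite big_mkcondr -sumrB /=; apply: eq_bigr => S _.
    by case: eqP; rewrite ?subrr ?subr0.
  rewrite -[X in X - _]mulr1 -mulrBr mulrC ler_pM2l //; lra.
(* A uniform relative election with margin [d] amounts to a uniform bloc of size [r]. *)
rewrite /uniform_prob dE rel_elections_withE // card_imfset_set; last exact: signed_blocs_inj.
rewrite Ccard ler_pdivlMr //; apply: le_trans goodE _.
rewrite ler_nat -(card_imfset_set good (@signed_blocs_inj V b)).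
apply: fsubset_leq_card; apply/fsubsetP => x /imfsetP[S /=]; rewrite inE => /andP[rS gS] ->.
rewrite !inE /=; apply/andP; split.
  by apply/imfsetP; exists S.
rewrite -dE; apply: (signed_blocs_agree hCC hM hN V0 d_gt1).
  by move: rS; rewrite inE dE => /eqP ->.
by move: rS; rewrite inE => /eqP ->.
Qed.
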